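(* Let $j\ge 1$ be such that $g_j>0$. If $\delta_j'<1/4$, then the series of real numbers $\sum_{n=0}^\infty\lambda_j^{(n)}$ and the series of Hilbert–Schmidt operators $\sum_{n=0}^\infty P_j^{(n)}$ converge absolutely (the latter in Hilbert–Schmidt norm), and $$\hat\lambda_j=\sum_{n=0}^\infty\lambda_j^{(n)}\qquad\text{and}\qquad\hat P_j=\sum_{n=0}^\infty P_j^{(n)}.$$
   Context: Setting. $\mathcal H$ is a separable Hilbert space of dimension $d\in\{2,3,\dots\}\cup\{\infty\}$; $(u\otimes v)x=\langle v,x\rangle u$. $\Sigma$ and $\hat\Sigma$ are self-adjoint compact operators on $\mathcal H$ (positive if $d=\infty$) with $\Sigma=\sum_{k\ge1}\lambda_kP_k$, $P_k=u_k\otimes u_k$, and $\hat\Sigma=\sum_{k\ge1}\hat\lambda_k\hat P_k$, $\hat P_k=\hat u_k\otimes\hat u_k$, where $\lambda_1\ge\lambda_2\ge\cdots$, $\hat\lambda_1\ge\hat\lambda_2\ge\cdots$, and $(u_k)$, $(\hat u_k)$ are orthonormal bases of $\mathcal H$. Put $E=\hat\Sigma-\Sigma$. $\|\cdot\|_\infty$ is the operator norm, $\|\cdot\|_2$ the Hilbert–Schmidt norm. Spectral gap: $g_1=\lambda_1-\lambda_2$ and $g_j=\min(\lambda_{j-1}-\lambda_j,\lambda_j-\lambda_{j+1})$ for $j\ge2$ (with $\lambda_{d+1}:=-\infty$ if $d<\infty$). For $g_j>0$ the reduced resolvent is $R_j=\sum_{k\ne j}(\lambda_k-\lambda_j)^{-1}P_k$,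 so $|R_j|^{1/2}=\sum_{k\neq j}|\lambda_k-\lambda_j|^{-1/2}P_k$; $R_j^{-1}$ denotes the generalized inverse $R_j^{-1}=\sum_{k\ne j}(\lambda_k-\lambda_j)P_k$. Define $$\delta_j'=\max\big(\||R_j|^{1/2}E|R_j|^{1/2}\|_\infty,\ g_j^{-1/2}\||R_j|^{1/2}EP_j\|_2,\ g_j^{-1}\|P_jEP_j\|_2\big).$$ For $n\ge0$, $$P_j^{(n)}=(-1)^{n+1}\sum_{\substack{k_1,\dots,k_{n+1}\ge0\\k_1+\dots+k_{n+1}=n}}R_j^{(k_1)}ER_j^{(k_2)}\cdots R_j^{(k_n)}ER_j^{(k_{n+1})},$$ where $R_j^{(0)}=-P_j$ and $R_j^{(k)}=R_j^k$ for $k>0$. Set $\lambda_j^{(0)}=\lambda_j$ and, for $n\ge1$, $\lambda_j^{(n)}=\operatorname{tr}(P_j^{(n-1)}E)+\operatorname{tr}(P_j^{(n)}R_j^{-1})$. *)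

(* Defs.v *)
From HB Require Import structures.
From mathcomp Require Import all_boot all_order all_algebra.
From mathcomp Require Import sesquilinear complex.
From mathcomp Require Import all_classical all_reals all_analysis.

Set Implicit Arguments.
Unset Strict Implicit.
Unset Printing Implicit Defensive.

Import Order.TTheory GRing.Theory Num.Theory.
Import numFieldNormedType.Exports.

Local Open Scope classical_set_scope.
Local Open Scope ring_scope.

(* Real or complex scalars, treated uniformly.  The axioms force K to be a copy
   of R (with trivial conjugation) or of R[i]: the fixed field of [conj] is the
   image of R, and [mul_conj] forces z^2 <= 0 for every z with conj z = - z.
   The two models are [real_scalars] and [complex_scalars] below. *)
Record scalars (R : realType) (K : numFieldType) := Scalars {
  emb : {rmorphism R -> K};
  conj : InvolutiveRMorphism.type K;
  re : K -> R;
  conj_emb : forall r, conj (emb r) = emb r;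
  mul_conj : forall z, z * conj z = `|z| ^+ 2;
  emb_re : forall z, emb (re z) = (z + conj z) / 2 }.

Definition real_scalars (R : realType) : scalars R R.
Proof.
apply: (@Scalars R R idfun idfun id) => //= z.
- by rewrite -expr2 real_normK ?num_real.
- by rewrite -mulr2n -[z *+ 2]mulr_natr mulfK ?pnatr_eq0.
Defined.

Definition complex_scalars (R : realType) : scalars R R[i].
Proof.
apply: (@Scalars R R[i] (complex.real_complex R) Num.conj
  (@complex.Re R)) => z.
- by rewrite -[LHS]/(complex.conjc _) /= oppr0.
- by rewrite normCK.
- by rewrite -[LHS]/(complex.real_complex R (complex.Re z)) complex.complexRe;
    exact: ReE.
Defined.

Section Hilbert.
Context (R : realType) (K : numFieldType) (F : scalars R K).
(* A Hilbert space is a complete normed module whose norm comes from a dot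
   product.  The library's forms are linear in the FIRST argument: [ip x v]
   is what is often written <v, x>. *)
Context (H : completeNormedModType K) (ip : {dot H for conj F}).

Definition norm_from_dot : Prop := forall x, ip x x = `|x| ^+ 2.

Definition rnorm (x : H) : R := re F `|x|.

(* [d = None] stands for infinite dimension; indices start at 1. *)
Definition in_dim (d : option nat) (k : nat) : bool :=
  (0 < k)%N && (if d is Some m then (k <= m)%N else true).

Definition tensor (u v : H) : H -> H := fun x => ip x v *: u.

Definition self_adjoint (A : H -> H) : Prop :=
  forall x y, ip (A x) y = ip x (A y).

Definition positive_op (A : H -> H) : Prop := forall x, 0 <= ip (A x) x.

Definition compact_op (A : H -> H) : Prop :=
  compact (closure (A @` [set x | `|x| <= 1])).

Definition opnorm (A : H -> H) : \bar R :=
  ereal_sup [set (rnorm (A x))%:E | x in [set x | `|x| <= 1]].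

Section Basis.
Context (d : option nat) (u : nat -> H).

(* partial sum of sum_k a_k (u_k (x) u_k) applied to x *)
Definition diag_partial (a : nat -> R) (x : H) (N : nat) : H :=
  \sum_(0 <= k < N | in_dim d k) emb F (a k) *: tensor (u k) (u k) x.

(* sum_k a_k (u_k (x) u_k), in the strong operator topology: for infinite d the
   reduced resolvent series does not converge in operator norm *)
Definition diag_op (a : nat -> R) (x : H) : H :=
  lim (diag_partial a x @ \oo).

Definition orthonormal_basis : Prop :=
  (forall k l, in_dim d k -> in_dim d l -> ip (u k) (u l) = (k == l)%:R) /\
  (forall x, diag_partial (fun=> 1) x @ \oo --> x).

Definition spectral_decomposition (A : H -> H) (lam : nat -> R) : Prop :=
  [/\ orthonormal_basis,
      (forall k l, in_dim d k -> in_dim d l -> (k <= l)%N -> lam l <= lam k)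
    & (forall x, diag_partial lam x @ \oo --> A x)].

Definition hsnorm (A : H -> H) : \bar R :=
  sqrte (\sum_(0 <= k <oo | in_dim d k) (rnorm (A (u k)) ^+ 2)%:E).

Definition hilbert_schmidt (A : H -> H) : Prop :=
  [/\ linear A, continuous A & (hsnorm A < +oo)%E].

Definition trace (A : H -> H) : K :=
  lim ((fun N : nat => \sum_(0 <= k < N | in_dim d k) ip (A (u k)) (u k))
        @ \oo).

Context (lam : nat -> R).

(* for j = d < oo the second term of the minimum is +oo and is dropped *)
Definition gap (j : nat) : R :=
  if j == 1%N then lam 1%N - lam 2%N
  else if d == Some j then lam j.-1 - lam j
  else Num.min (lam j.-1 - lam j) (lam j - lam j.+1).

Context (j : nat).

Definition eig_proj : H -> H := tensor (u j) (u j).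

Definition resolvent : H -> H :=
  diag_op (fun k => if k == j then 0 else (lam k - lam j)^-1).

Definition abs_resolvent_sqrt : H -> H :=
  diag_op (fun k => if k == j then 0 else (Num.sqrt `|lam k - lam j|)^-1).

Definition resolvent_ginv : H -> H :=
  diag_op (fun k => if k == j then 0 else lam k - lam j).

Context (E : H -> H).

Definition delta' : \bar R :=
  maxe (opnorm (abs_resolvent_sqrt \o E \o abs_resolvent_sqrt))
    (maxe (((Num.sqrt (gap j))^-1)%:E * hsnorm (abs_resolvent_sqrt \o E \o eig_proj))
          (((gap j)^-1)%:E * hsnorm (eig_proj \o E \o eig_proj)))%E.

Definition res_pow (k : nat) : H -> H :=
  if k == 0%N then (fun x => - eig_proj x) else iter k resolvent.

(* R^(k_1) E R^(k_2) ... E R^(k_m) for s = [:: k_1; ...; k_m], m > 0 *)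
Fixpoint res_word (s : seq nat) : H -> H :=
  match s with
  | [::] => id
  | [:: k] => res_pow k
  | k :: s' => res_pow k \o E \o res_word s'
  end.

Definition proj_term (n : nat) : H -> H := fun x =>
  (-1) ^+ n.+1 *:
  \sum_(k : n.+1.-tuple 'I_n.+1 | (\sum_(i <- k) i == n)%N)
     res_word [seq nat_of_ord i | i <- k] x.

Definition eigenvalue_term (n : nat) : K :=
  if n is m.+1 then
    trace (proj_term m \o E) + trace (proj_term m.+1 \o resolvent_ginv)
  else emb F (lam j).

End Basis.
End Hilbert.

(* Main.v *)
(* Let [W n m] be the sum of the words R^(k_1) E ... E R^(k_(n+1)) with
   k_1 + ... + k_(n+1) = m, so that P_n = (-1)^(n+1) W n n, and put D = S - lam_j
   and Dh = D + E = Sh - lam_j.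

   Bounds.  With A = |R_j|^(1/2) + g^(-1/2) P_j one has R^(k) = A M_k A with
   |M_k| <= g^(1-k) and M_k block diagonal for P_j, 1 - P_j, while every block of
   A E A has norm at most delta.  Hence each word is bounded by delta^n g^(n-m), and
   |W n m| <= 2^(n+m) delta^n g^(n-m).  A word containing R^(0) = - P_j has rank one,
   so that this is also a bound of its Hilbert-Schmidt norm and of its trace.

   Localisation.  The same block bounds give |<E x, x>| <= 2 delta <A^(-2) x, x>,
   whence by min-max |lamh_j - lam_j| <= 2 delta g and
   |lamh_k - lam_j| >= (1 - 2 delta) g for k <> j.

   Identification.  From D W (n+1) (m+1) = W (n+1) m + E W n m, the alternating sums
   Z_c of W n m along the diagonal n - m = c satisfy Dh Z_c = Z_(c+1) for c >= 0,
   where Z_0 = sum P_n, and Dh Z_(-c) = Z_(1-c), except that Dh Z_(-1) = Z_0 - 1.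
   Since |Z_c| = O((2 delta g)^c) and |Z_(-c)| = O((2 / g)^c), taking matrix elements
   with the eigenvectors of Sh shows that Z_0 annihilates those of index k <> j and
   fixes that of index j, as 2 delta < 1 - 2 delta and 4 delta < 1.  Finally
   lam_n = (-1)^(n+1) tr W n (n-1), and these sum to tr (Dh Ph_j) = lamh_j - lam_j. *)

Require Import Defs.
From HB Require Import structures.
From mathcomp Require Import all_boot all_order all_algebra.
From mathcomp Require Import sesquilinear.
From mathcomp Require Import all_classical all_reals all_analysis.
From mathcomp Require Import ring lra.

Set Implicit Arguments.
Unset Strict Implicit.
Unset Printing Implicit Defensive.

Import Order.TTheory GRing.Theory Num.Theory.
Import numFieldNormedType.Exports.

Local Open Scope classical_set_scope.
Local Open Scope ring_scope.

(** * Real-valued norms and convergence over real or complex scalars *)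

Section Scalars.
Context (R : realType) (K : numFieldType) (F : scalars R K).
Local Notation e := (emb F).
Local Notation cj := (conj F).

Lemma emb_inj : injective e.
Proof. exact: fmorph_inj. Qed.

(** The square root of [r] embeds to an element fixed by the conjugation, so [mul_conj] turns its
    square into the square of an absolute value. All order properties of [e] follow from this. *)
Lemma emb_ge0_of (r : R) : 0 <= r -> 0 <= e r.
Proof.
move=> r0; rewrite -(sqr_sqrtr r0) rmorphXn expr2.
by rewrite -{2}(conj_emb F) mul_conj exprn_ge0.
Qed.

Lemma emb_ge0 (r : R) : (0 <= e r) = (0 <= r).
Proof.
apply/idP/idP => [er0|]; last exact: emb_ge0_of.
case: (leP 0 r) => // r0.
have : 0 <= e (- r) by apply: emb_ge0_of; rewrite oppr_ge0 ltW.
rewrite rmorphN oppr_ge0 => er0'.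
have /eqP : e r = 0 by apply/le_anti; rewrite er0' er0.
by rewrite fmorph_eq0 => /eqP r00; move: r0; rewrite r00 ltxx.
Qed.

Lemma ler_emb (x y : R) : (e x <= e y) = (x <= y).
Proof. by rewrite -subr_ge0 -rmorphB emb_ge0 subr_ge0. Qed.

Lemma ltr_emb (x y : R) : (e x < e y) = (x < y).
Proof. by rewrite !lt_neqAle ler_emb (inj_eq emb_inj). Qed.

Lemma re_emb (r : R) : re F (e r) = r.
Proof.
apply: emb_inj; rewrite emb_re conj_emb -mulr2n -[e r *+ 2]mulr_natr.
by rewrite mulfK ?pnatr_eq0.
Qed.

Lemma conjK z : cj (cj z) = z.
Proof. exact: rmorphK. Qed.

Lemma norm_conj z : `|cj z| = `|z|.
Proof.
by apply/eqP; rewrite -(@eqrXn2 _ 2) // -!(mul_conj F) conjK mulrC.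
Qed.

(** For [z >= 0], [mul_conj] reads z conj(z) = z^2; cancelling a nonzero z shows that z is fixed by
    the conjugation. *)
Lemma emb_re_ge0 (z : K) : 0 <= z -> e (re F z) = z.
Proof.
move=> z0; suff zr : cj z = z.
  by rewrite emb_re zr -mulr2n -[z *+ 2]mulr_natr mulfK ?pnatr_eq0.
have := mul_conj F z; rewrite ger0_norm // expr2.
have [->|z_neq0] := eqVneq z 0; first by rewrite rmorph0.
by move/(mulfI z_neq0).
Qed.

Lemma re_ge0 (z : K) : 0 <= z -> 0 <= re F z.
Proof. by move=> z0; rewrite -emb_ge0 emb_re_ge0. Qed.

Lemma reD z w : re F (z + w) = re F z + re F w.
Proof. by apply: emb_inj; rewrite rmorphD !emb_re rmorphD; field. Qed.

Lemma re0 : re F 0 = 0.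
Proof. by rewrite -(rmorph0 e) re_emb. Qed.

Lemma reN z : re F (- z) = - re F z.
Proof. by apply: emb_inj; rewrite rmorphN !emb_re rmorphN; field. Qed.

Lemma reB z w : re F (z - w) = re F z - re F w.
Proof. by rewrite reD reN. Qed.

Lemma re_conj z : re F (cj z) = re F z.
Proof. by apply: emb_inj; rewrite !emb_re conjK addrC. Qed.

Lemma re_embM (r : R) z : re F (e r * z) = r * re F z.
Proof.
apply: emb_inj; rewrite rmorphM !emb_re [cj (_ * _)]rmorphM /= conj_emb.
by rewrite -mulrDr mulrA.
Qed.

Lemma re_sum (I : Type) (s : seq I) (P : pred I) (f : I -> K) :
  re F (\sum_(i <- s | P i) f i) = \sum_(i <- s | P i) re F (f i).
Proof. by apply: (big_morph (re F)); [exact: reD|exact: re0]. Qed.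

(** The library norm takes values in [K]; this real copy allows total-order arguments and real
    limits. On [H] it unfolds to the same term as [rnorm]. *)
Definition nrm (V : normedZmodType K) (x : V) : R := re F `|x|.

Section Nrm.
Context (V : normedZmodType K).
Implicit Types x y : V.

Lemma emb_nrm x : e (nrm x) = `|x|.
Proof. exact: emb_re_ge0. Qed.

Lemma nrm_ge0 x : 0 <= nrm x.
Proof. exact: re_ge0. Qed.

Lemma nrm0 : nrm (0 : V) = 0.
Proof. by rewrite /nrm normr0 re0. Qed.

Lemma nrmN x : nrm (- x) = nrm x.
Proof. by rewrite /nrm normrN. Qed.

Lemma nrmBC x y : nrm (x - y) = nrm (y - x).
Proof. by rewrite -nrmN opprB. Qed.

Lemma nrm_eq0 x : (nrm x == 0) = (x == 0).
Proof. by rewrite -(fmorph_eq0 e) emb_nrm normr_eq0. Qed.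

Lemma nrmD x y : nrm (x + y) <= nrm x + nrm y.
Proof. by rewrite -ler_emb rmorphD !emb_nrm ler_normD. Qed.

Lemma nrmB x y : nrm (x - y) <= nrm x + nrm y.
Proof. by rewrite -(nrmN y) nrmD. Qed.

Lemma nrm_le_dist x y : nrm x <= nrm y + nrm (x - y).
Proof. by rewrite addrC -{1}(subrK y x) nrmD. Qed.

Lemma nrm_sum (I : Type) (s : seq I) (P : pred I) (f : I -> V) :
  nrm (\sum_(i <- s | P i) f i) <= \sum_(i <- s | P i) nrm (f i).
Proof.
elim/big_ind2: _ => [|x1 x2 y1 y2 h1 h2|//]; first by rewrite nrm0.
exact: le_trans (nrmD _ _) (lerD h1 h2).
Qed.

End Nrm.

Lemma nrmZ (V : normedModType K) (a : K) (x : V) :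
  nrm (a *: x) = nrm a * nrm x.
Proof. by apply: emb_inj; rewrite rmorphM !emb_nrm normrZ. Qed.

Lemma nrmM (a b : K) : nrm (a * b) = nrm a * nrm b.
Proof. by apply: emb_inj; rewrite rmorphM !emb_nrm normrM. Qed.

Lemma nrmX (a : K) n : nrm (a ^+ n) = nrm a ^+ n.
Proof. by apply: emb_inj; rewrite rmorphXn !emb_nrm normrX. Qed.

Lemma nrm1 : nrm (1 : K) = 1.
Proof. by rewrite /nrm normr1 -(rmorph1 e) re_emb. Qed.

Lemma nrm_emb (r : R) : nrm (e r) = `|r|.
Proof.
wlog r0 : r / 0 <= r => [h|].
  case: (leP 0 r) => r0; first exact: h.
  by rewrite -nrmN -rmorphN h ?oppr_ge0 1?ltW // normrN.
by rewrite (ger0_norm r0) /nrm (ger0_norm (emb_ge0_of r0)) re_emb.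
Qed.

Lemma nrm_sign n : nrm ((-1) ^+ n : K) = 1.
Proof. by rewrite nrmX nrmN nrm1 expr1n. Qed.

Lemma nrm_sqr (z : K) : e (nrm z ^+ 2) = z * cj z.
Proof. by rewrite rmorphXn emb_nrm mul_conj. Qed.

Lemma nrm_conj (z : K) : nrm (cj z) = nrm z.
Proof. by rewrite /nrm norm_conj. Qed.

Lemma re_le_nrm z : re F z <= nrm z.
Proof.
have : `|e (re F z)| <= `|z|.
  rewrite emb_re normrM normfV normr_nat ler_pdivrMr ?ltr0n //.
  by rewrite (le_trans (ler_normD _ _)) // norm_conj -mulr2n -[leLHS]mulr_natr.
rewrite -[`|e _|]emb_nrm nrm_emb -(emb_nrm z) ler_emb => h.
by rewrite (le_trans (ler_norm _)).
Qed.

Lemma abs_re_le z : `|re F z| <= nrm z.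
Proof. by rewrite ler_norml lerNl -reN -{1}(nrmN z) !re_le_nrm. Qed.

Section Cvg.
Context (V : normedModType K).

Lemma cvg_nrm (T : Type) (G : set_system T) {FG : Filter G} (f : T -> V) (l : V) :
  f @ G --> l <-> nrm (f t - l) @[t --> G] --> (0 : R).
Proof.
split=> [/cvgrPdist_lt h|/cvgr0Pnorm_lt h].
- apply/cvgr0Pnorm_lt => eps eps0.
  have /h : 0 < e eps by rewrite -(rmorph0 e) ltr_emb.
  apply: filterS => t; rewrite distrC -emb_nrm ltr_emb.
  by rewrite ger0_norm ?nrm_ge0.
- apply/cvgrPdist_lt => eps eps0.
  have /h : 0 < re F eps by rewrite -ltr_emb rmorph0 emb_re_ge0 // ltW.
  apply: filterS => t; rewrite distrC ger0_norm ?nrm_ge0 // -ltr_emb.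
  by rewrite emb_nrm emb_re_ge0 // ltW.
Qed.

Lemma cvg_nrm_le (T : Type) (G : set_system T) {FG : Filter G}
    (f : T -> V) (l : V) (b : T -> R) :
  (forall t, nrm (f t - l) <= b t) -> b @ G --> (0 : R) -> f @ G --> l.
Proof.
move=> fb b0; apply/cvg_nrm.
apply: (@squeeze_cvgr _ _ _ _ (fun=> 0) b) => //; last exact: cvg_cst.
by apply: nearW => t; rewrite nrm_ge0 fb.
Qed.

Lemma cvg_of_nrm (T : Type) (G : set_system T) {FG : Filter G}
    (f : T -> V) (l : V) :
  f @ G --> l -> nrm (f t) @[t --> G] --> nrm l.
Proof.
move=> /cvg_nrm fl; apply/cvgrPdist_lt => eps eps0.
move/cvgr0Pnorm_lt: fl => /(_ _ eps0).
apply: filterS => t; rewrite ger0_norm ?nrm_ge0 //; apply: le_lt_trans.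
rewrite ler_norml; apply/andP; split.
  by rewrite lerNl opprB lerBlDl nrm_le_dist.
by rewrite lerBlDl nrmBC nrm_le_dist.
Qed.

End Cvg.

Lemma cvg_emb (T : Type) (G : set_system T) {FG : Filter G} (f : T -> R) (l : R) :
  f @ G --> l -> (e (f t) : K^o) @[t --> G] --> (e l : K^o).
Proof.
move=> /cvgrPdist_lt fl; apply/(@cvg_nrm K^o); apply/cvgr0Pnorm_lt => eps /fl.
by apply: filterS => t; rewrite -rmorphB nrm_emb normr_id distrC.
Qed.

Lemma cvg_re (T : Type) (G : set_system T) {FG : Filter G} (f : T -> K^o) (l : K^o) :
  f @ G --> l -> re F (f t) @[t --> G] --> re F l.
Proof.
move=> /cvg_nrm /cvgr0Pnorm_lt fl; apply/cvgrPdist_lt => eps /fl.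
apply: filterS => t; rewrite ger0_norm ?nrm_ge0 //; apply: le_lt_trans.
by rewrite distrC -reB abs_re_le.
Qed.

Lemma cauchy_nrm_cvg (H : completeNormedModType K) (f : nat -> H) :
  (forall eps : R, 0 < eps -> exists N, forall m n, (N <= m)%N -> (m <= n)%N ->
     nrm (f n - f m) < eps) ->
  cvg (f @ \oo).
Proof.
move=> fc; apply/cauchy_cvgP/cauchy_exP => eps eps0.
have eps0' : 0 < re F eps by rewrite -ltr_emb rmorph0 emb_re_ge0 // ltW.
have [N hN] := fc _ eps0'; exists (f N); exists N => // n Nn.
rewrite /= -ball_normE /= distrC -emb_nrm -(emb_re_ge0 (ltW eps0)) ltr_emb.
exact: hN.
Qed.

End Scalars.

(** * Limits of real sequences and of Lipschitz images *)

Section RealSequences.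
Context (R : realType).

(* A bound whose constant may depend on the exponent [c] of the first,
   [N]-independent, term still forces convergence to 0. *)
Lemma cvg0_of_two_rates (s : nat -> R) (B r q : R) :
  0 <= r < 1 -> 0 <= q < 1 ->
  (forall c, exists C M, forall n, (M <= n)%N ->
     `|s n| <= B * r ^+ c + C * q ^+ (n - M)) ->
  s @ \oo --> (0 : R).
Proof.
move=> /andP[r0 r1] /andP[q0 q1] h; apply/cvgr0Pnorm_lt => eps eps0.
have /cvgr0Pnorm_lt /(_ (eps / 2)) : geometric B r @ \oo --> (0 : R).
  by apply: cvg_geometric; rewrite ger0_norm.
rewrite divr_gt0 // => /(_ isT) [c _ /(_ c (leqnn c)) /= hc].
have [C [M hM]] := h c.
have /cvgr0Pnorm_lt /(_ (eps / 2)) : geometric C q @ \oo --> (0 : R).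
  by apply: cvg_geometric; rewrite ger0_norm.
rewrite divr_gt0 // => /(_ isT) [L _ hL].
exists (M + L)%N => // n /= Mn.
have h1 := hM n (leq_trans (leq_addr _ _) Mn).
have /hL /= h2 : (L <= n - M)%N by rewrite leq_subRL // (leq_trans _ Mn) // leq_addr.
have := ler_norm (B * r ^+ c); have := ler_norm (C * q ^+ (n - M)).
lra.
Qed.

End RealSequences.

Section LipschitzLimits.
Context (R : realType) (K : numFieldType) (F : scalars R K).

Lemma cvg_lipschitz (V W : normedModType K) (T : V -> W) (M : R)
    (I : Type) (G : set_system I) {FG : Filter G} (f : I -> V) (l : V) :
  (forall x y, nrm F (T x - T y) <= M * nrm F (x - y)) ->
  f @ G --> l -> T (f t) @[t --> G] --> T l.
Proof.
move=> Tl /(cvg_nrm F) fl; apply: (@cvg_nrm_le _ _ F _ _ _ _ _ _ _ (fun t => Tl (f t) l)).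
by rewrite -(mulr0 M); apply: cvgM => //; exact: cvg_cst.
Qed.

End LipschitzLimits.

(** * Inner product: Cauchy-Schwarz, continuity, linear maps *)

Section InnerProduct.
Context (R : realType) (K : numFieldType) (F : scalars R K).
Context (H : completeNormedModType K) (ip : {dot H for conj F}).
Context (ip_norm : norm_from_dot ip).
Local Notation e := (emb F).
Local Notation cj := (conj F).
Local Notation N := (nrm F).
Implicit Types x y z : H.

Lemma ipC x y : ip x y = cj (ip y x).
Proof. by rewrite hermC expr0 mul1r. Qed.

Lemma ipDl x y z : ip (x + y) z = ip x z + ip y z.
Proof. exact: linearDl. Qed.

Lemma ipZl a x z : ip (a *: x) z = a * ip x z.
Proof. exact: linearZl_LR. Qed.

Lemma ip0l z : ip 0 z = 0.
Proof. exact: linear0l. Qed.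

Lemma ipNl x z : ip (- x) z = - ip x z.
Proof. exact: linearNl. Qed.

Lemma ipBl x y z : ip (x - y) z = ip x z - ip y z.
Proof. exact: linearBl. Qed.

Lemma ip_suml (I : Type) (s : seq I) (P : pred I) (f : I -> H) z :
  ip (\sum_(i <- s | P i) f i) z = \sum_(i <- s | P i) ip (f i) z.
Proof. by apply: (big_morph (ip^~ z)) => [x y|]; rewrite ?ipDl ?ip0l. Qed.

Lemma ipDr x y z : ip z (x + y) = ip z x + ip z y.
Proof. exact: linearDr. Qed.

Lemma ip0r z : ip z 0 = 0.
Proof. exact: linear0r. Qed.

Lemma ipBr x y z : ip z (x - y) = ip z x - ip z y.
Proof. exact: linearBr. Qed.

Lemma ipZr a x z : ip z (a *: x) = cj a * ip z x.
Proof. exact: linearZr_LR. Qed.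

Lemma ip_sumr (I : Type) (s : seq I) (P : pred I) (f : I -> H) z :
  ip z (\sum_(i <- s | P i) f i) = \sum_(i <- s | P i) ip z (f i).
Proof. by apply: (big_morph (ip z)) => [x y|]; rewrite ?ipDr ?ip0r. Qed.

Lemma ip_sqr x : ip x x = e (N x ^+ 2).
Proof. by rewrite ip_norm rmorphXn emb_nrm. Qed.

Lemma re_ip_sqr x : re F (ip x x) = N x ^+ 2.
Proof. by rewrite ip_sqr re_emb. Qed.

Lemma nrm_sqrD x y :
  N (x + y) ^+ 2 = N x ^+ 2 + 2 * re F (ip x y) + N y ^+ 2.
Proof.
rewrite -!re_ip_sqr ipDl !ipDr !reD (ipC y x) re_conj.
by rewrite mulr_natl mulr2n !addrA.
Qed.

Lemma nrm_ip_le x y : nrm F (ip x y) <= N x * N y.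
Proof.
have [->|y0] := eqVneq y 0; first by rewrite ip0r !nrm0 mulr0.
have t0 : 0 < N y ^+ 2 by rewrite exprn_gt0 // lt0r nrm_eq0 y0 nrm_ge0.
set t := N y ^+ 2 in t0; set p := nrm F (ip x y).
(* This vector is |y|^2 times the component of [x] orthogonal to [y]. *)
have : 0 <= N (e t *: x + (- ip x y) *: y) ^+ 2 by rewrite exprn_ge0 ?nrm_ge0.
rewrite nrm_sqrD !nrmZ nrmN -/p ipZl ipZr nrm_emb rmorphN mulNr mulrN reN.
rewrite re_embM [cj _ * _]mulrC -nrm_sqr -/p re_emb (gtr0_norm t0).
rewrite !exprMn -/t => h.
have {}h : 0 <= t * (t * N x ^+ 2 - p ^+ 2).
  by apply: le_trans h _; rewrite le_eqVlt; apply/orP; left; apply/eqP; ring.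
rewrite pmulr_rge0 // subr_ge0 /t -exprMn mulrC in h.
by rewrite -(@ler_pXn2r _ 2) ?nnegrE ?mulr_ge0 ?nrm_ge0.
Qed.

Lemma cvg_ipl (I : Type) (G : set_system I) {FG : Filter G} (f : I -> H) l y :
  f @ G --> l -> (ip (f t) y : K^o) @[t --> G] --> (ip l y : K^o).
Proof.
apply: (@cvg_lipschitz _ _ F H K^o (fun x => ip x y) (N y)) => x z.
by rewrite -ipBl mulrC; exact: nrm_ip_le.
Qed.

Lemma cvg_ipr (I : Type) (G : set_system I) {FG : Filter G} (f : I -> H) l y :
  f @ G --> l -> (ip y (f t) : K^o) @[t --> G] --> (ip y l : K^o).
Proof.
apply: (@cvg_lipschitz _ _ F H K^o (fun x => ip y x) (N y)) => x z.
by rewrite -ipBr; exact: nrm_ip_le.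
Qed.

Section LinearMaps.
Context (T : H -> H) (T_lin : linear T).

Lemma lin0 : T 0 = 0.
Proof. by have := T_lin (-1) 0 0; rewrite scaler0 addr0 scaleN1r addNr. Qed.

Lemma linZ a x : T (a *: x) = a *: T x.
Proof. by have := T_lin a x 0; rewrite lin0 !addr0. Qed.

Lemma linD x y : T (x + y) = T x + T y.
Proof. by have := T_lin 1 x y; rewrite !scale1r. Qed.

Lemma linN x : T (- x) = - T x.
Proof. by rewrite -scaleN1r linZ scaleN1r. Qed.

Lemma linB x y : T (x - y) = T x - T y.
Proof. by rewrite linD linN. Qed.

Lemma lin_sum (I : Type) (s : seq I) (P : pred I) (f : I -> H) :
  T (\sum_(i <- s | P i) f i) = \sum_(i <- s | P i) T (f i).
Proof. by apply: (big_morph T) => [x y|]; rewrite ?linD ?lin0. Qed.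

Context (M : R) (T_bd : forall x, N (T x) <= M * N x).

Lemma cvg_lin (I : Type) (G : set_system I) {FG : Filter G} (f : I -> H) l :
  f @ G --> l -> T (f t) @[t --> G] --> T l.
Proof. by apply: (cvg_lipschitz (F := F) (M := M)) => x y; rewrite -linB. Qed.

Lemma lin_continuous : continuous T.
Proof. by move=> x; apply: cvg_lin. Qed.

End LinearMaps.

(** The defect of linearity is orthogonal to every vector, hence to itself. Linearity of diagonal
    operators, of [E] and of the word sums is obtained this way. *)
Lemma adjoint_linear (T T' : H -> H) :
  (forall x y, ip (T x) y = ip x (T' y)) -> linear T.
Proof.
move=> sa a x y; apply/eqP; rewrite -subr_eq0 -(nrm_eq0 F) -sqrf_eq0.
rewrite -re_ip_sqr -(re0 F); apply/eqP; congr re.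
by rewrite ipBl ipDl ipZl !sa ipDl ipZl subrr.
Qed.

End InnerProduct.

(** * Orthonormal bases and operators diagonal in them *)

Section Basis.
Context (R : realType) (K : numFieldType) (F : scalars R K).
Context (H : completeNormedModType K) (ip : {dot H for conj F}).
Context (ip_norm : norm_from_dot ip).
Context (d : option nat) (u : nat -> H) (u_onb : orthonormal_basis ip d u).
Local Notation e := (emb F).
Local Notation cj := (conj F).
Local Notation N := (nrm F).
Implicit Types x y z : H.

Lemma onb_ip k l : in_dim d k -> in_dim d l -> ip (u k) (u l) = (k == l)%:R.
Proof. by case: u_onb => + _; exact. Qed.

Lemma onb_nrm k : in_dim d k -> N (u k) = 1.
Proof.
move=> kd; apply/eqP; rewrite -(@eqrXn2 _ 2) ?nrm_ge0 // expr1n.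
by rewrite -(re_ip_sqr ip_norm) onb_ip // eqxx -(rmorph1 e) re_emb.
Qed.

Lemma comb_coord m n (f : nat -> K) l : in_dim d l ->
  ip (\sum_(m <= k < n | in_dim d k) f k *: u k) (u l) =
  if (m <= l < n)%N then f l else 0.
Proof.
move=> ld; rewrite ip_suml.
transitivity (\sum_(m <= k < n | k == l) f k); last by rewrite big_nat1_eq.
rewrite [LHS]big_mkcond [RHS]big_mkcond; apply: eq_bigr => k _.
have [->|kl] := eqVneq k l; first by rewrite ld ipZl onb_ip // eqxx mulr1.
by case: ifP => // kd; rewrite ipZl onb_ip // (negPf kl) mulr0.
Qed.

Lemma comb_ip m n (f : nat -> K) x :
  ip x (\sum_(m <= k < n | in_dim d k) f k *: u k) =
  \sum_(m <= k < n | in_dim d k) cj (f k) * ip x (u k).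
Proof. by rewrite ip_sumr; apply: eq_bigr => k _; rewrite ipZr. Qed.

Lemma comb_nrm m n (f : nat -> K) :
  N (\sum_(m <= k < n | in_dim d k) f k *: u k) ^+ 2 =
  \sum_(m <= k < n | in_dim d k) nrm F (f k) ^+ 2.
Proof.
apply: (emb_inj (F := F)); rewrite -(ip_sqr ip_norm) comb_ip rmorph_sum.
rewrite big_nat_cond [RHS]big_nat_cond; apply: eq_bigr => k /andP[mkn kd].
by rewrite comb_coord // mkn nrm_sqr mulrC.
Qed.

Definition proj_range m n x := \sum_(m <= k < n | in_dim d k) ip x (u k) *: u k.

Lemma proj_range_le m n x : N (proj_range m n x) <= N x.
Proof.
rewrite -(@ler_pXn2r _ 2) ?nnegrE ?nrm_ge0 //.
set p := proj_range m n x.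
have h : re F (ip (x - p) p) = 0.
  rewrite -(re0 F); congr re; rewrite comb_ip big_nat_cond big1 // => k.
  by case/andP => mkn kd; rewrite ipBl comb_coord // mkn subrr mulr0.
have := nrm_sqrD ip_norm (x - p) p; rewrite h subrK mulr0 addr0 => ->.
by rewrite lerDr exprn_ge0 ?nrm_ge0.
Qed.

Lemma bessel m n x :
  \sum_(m <= k < n | in_dim d k) nrm F (ip x (u k)) ^+ 2 <= N x ^+ 2.
Proof.
by rewrite -(comb_nrm m n (fun k => ip x (u k))) ler_pXn2r ?nnegrE ?nrm_ge0 ?proj_range_le.
Qed.

Lemma proj_range_cvg x : (fun n => proj_range 0 n x) @ \oo --> x.
Proof.
case: u_onb => _ /(_ x).
suff -> : diag_partial ip d u (fun=> 1) x = (fun n => proj_range 0 n x) by [].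
by apply: funext => n; apply: eq_bigr => k _; rewrite rmorph1 scale1r.
Qed.

Lemma onb_ext x y : (forall k, in_dim d k -> ip x (u k) = ip y (u k)) -> x = y.
Proof.
move=> xy.
have := @proj_range_cvg y; have := @proj_range_cvg x.
suff -> : (fun n => proj_range 0 n x) = (fun n => proj_range 0 n y).
  exact: cvg_unique.
by apply: funext => n; apply: eq_bigr => k kd; rewrite xy.
Qed.

Lemma coord_of_cvg a x y l : in_dim d l ->
  diag_partial ip d u a x @ \oo --> y -> ip y (u l) = e (a l) * ip x (u l).
Proof.
move=> ld /(cvg_ipl ip_norm (y := u l)) h.
apply: (cvg_unique _ h) => //.
suff : \forall n \near \oo, (e (a l) * ip x (u l) : K^o) =
    ip (diag_partial ip d u a x n) (u l).
  by move/near_eq_cvg => h'; apply: (cvg_trans h'); exact: cvg_cst.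
exists l.+1 => // n /= ln.
transitivity (ip (\sum_(0 <= k < n | in_dim d k) (e (a k) * ip x (u k)) *: u k) (u l)).
  by rewrite comb_coord // ln.
by congr (ip _ _); apply: eq_bigr => k _; rewrite scalerA.
Qed.

(** Cauchy criterion: a block of the diagonal series has norm at most [M] times the same block of
    the expansion of [x]. *)
Lemma diag_cvg a (M : R) x : (forall k, in_dim d k -> `|a k| <= M) ->
  cvg (diag_partial ip d u a x @ \oo).
Proof.
move=> aM; apply: (cauchy_nrm_cvg (F := F)) => eps eps0.
(* The maximum with 1 allows division by the bound. *)
set M' := Num.max M 1.
have M'0 : 0 < M' by rewrite lt_max ltr01 orbT.
have /(cvg_nrm F) /cvgr0Pnorm_lt /(_ (eps / (2 * M'))) := @proj_range_cvg x.
rewrite divr_gt0 ?mulr_gt0 // => /(_ isT) [n0 _ h]; exists n0 => m n n0m mn.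
have -> : diag_partial ip d u a x n - diag_partial ip d u a x m =
    \sum_(m <= k < n | in_dim d k) (e (a k) * ip x (u k)) *: u k.
  rewrite /diag_partial (big_cat_nat (n := m)) //= addrAC subrr add0r.
  by apply: eq_bigr => k _; rewrite scalerA.
have pd : proj_range 0 n x - proj_range 0 m x = proj_range m n x.
  by rewrite /proj_range (big_cat_nat (n := m)) //= addrAC subrr add0r.
have h1 : N (proj_range m n x) < eps / M'.
  rewrite -pd; have := nrmB F (proj_range 0 n x - x) (proj_range 0 m x - x).
  rewrite opprB addrA subrK; move/le_lt_trans; apply.
  have := h n (leq_trans n0m mn); have := h m n0m.
  rewrite /= !ger0_norm ?nrm_ge0 // => h2 h3.
  by rewrite [ltRHS](_ : _ = eps / (2 * M') + eps / (2 * M')) ?ltrD //; field;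
    rewrite gt_eqF.
rewrite ltr_pdivlMr // mulrC in h1; apply: le_lt_trans h1.
rewrite -(@ler_pXn2r _ 2) ?nnegrE ?mulr_ge0 ?nrm_ge0 ?(ltW M'0) //.
rewrite comb_nrm exprMn (comb_nrm m n (fun k => ip x (u k))) mulr_sumr.
apply: ler_sum => k kd; rewrite nrmM exprMn ler_wpM2r ?exprn_ge0 ?nrm_ge0 //.
rewrite nrm_emb ler_pXn2r ?nnegrE ?(ltW M'0) //.
by rewrite (le_trans (aM _ kd)) // le_max lexx.
Qed.

(** Stated on coordinates and not as an equality with [diag_op], this is stable under sums,
    composition and iteration, and it covers both the limits [diag_op] and the given operators [S]
    and [Sh]. *)
Definition is_diag (T : H -> H) (a : nat -> R) :=
  forall x k, in_dim d k -> ip (T x) (u k) = e (a k) * ip x (u k).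

Lemma diag_op_is_diag a (M : R) : (forall k, in_dim d k -> `|a k| <= M) ->
  is_diag (diag_op ip d u a) a.
Proof. by move=> aM x k kd; apply: coord_of_cvg => //; apply: diag_cvg aM. Qed.

Section Diag.
Context (T : H -> H) (a : nat -> R) (Ta : is_diag T a).

Lemma is_diag_basis k : in_dim d k -> T (u k) = e (a k) *: u k.
Proof.
move=> kd; apply: onb_ext => l ld; rewrite Ta // ipZl onb_ip //.
by have [->|] := eqVneq k l; rewrite ?mulr0.
Qed.

Lemma is_diag_self_adjoint : self_adjoint ip T.
Proof.
move=> x y; apply: (cvg_unique _ (cvg_ipr ip_norm (y := T x) (@proj_range_cvg y))) => //.
have := cvg_ipr ip_norm (y := x) (@proj_range_cvg (T y)).
suff E : forall n, ip x (proj_range 0 n (T y)) = ip (T x) (proj_range 0 n y).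
  by under eq_fun do rewrite E; exact.
move=> n.
rewrite !comb_ip; apply: eq_bigr => k kd; rewrite !Ta // rmorphM /= conj_emb.
by rewrite mulrCA mulrA.
Qed.

Lemma is_diag_linear : linear T.
Proof. exact: (adjoint_linear ip_norm is_diag_self_adjoint). Qed.

Lemma is_diag_bounded (M : R) : 0 <= M -> (forall k, in_dim d k -> `|a k| <= M) ->
  forall x, N (T x) <= M * N x.
Proof.
move=> M0 aM x.
have h : N (proj_range 0 n (T x)) @[n --> \oo] --> N (T x).
  exact: (cvg_of_nrm (F := F) (@proj_range_cvg (T x))).
apply: (ler_cvg_to h (cvg_cst (M * N x))); apply: nearW => n.
rewrite -(@ler_pXn2r _ 2) ?nnegrE ?mulr_ge0 ?nrm_ge0 //.
rewrite (comb_nrm 0 n (fun k => ip (T x) (u k))) exprMn.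
apply: le_trans (_ : M ^+ 2 * \sum_(0 <= k < n | in_dim d k) nrm F (ip x (u k)) ^+ 2 <= _);
  last by rewrite ler_wpM2l ?exprn_ge0 ?bessel.
rewrite mulr_sumr; apply: ler_sum => k kd.
rewrite Ta // nrmM exprMn ler_wpM2r ?exprn_ge0 ?nrm_ge0 //.
by rewrite nrm_emb ler_pXn2r ?nnegrE // aM.
Qed.

(** The coefficients are bounded only where [x] has a nonzero coordinate, so that the test vectors
    of the min-max argument, supported on one side of an index, are admissible. *)
Lemma is_diag_form_le (b : R) x :
  (forall k, in_dim d k -> ip x (u k) != 0 -> a k <= b) ->
  re F (ip (T x) x) <= b * N x ^+ 2.
Proof.
move=> ab.
have h1 : re F (ip (T x) (proj_range 0 n x)) @[n --> \oo] --> re F (ip (T x) x).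
  by apply: (cvg_re (F := F)); apply: (cvg_ipr ip_norm (y := T x)); exact: proj_range_cvg.
have h2 : b * N (proj_range 0 n x) ^+ 2 @[n --> \oo] --> b * N x ^+ 2.
  have h : N (proj_range 0 n x) @[n --> \oo] --> N x.
    exact: (cvg_of_nrm (F := F) (@proj_range_cvg x)).
  apply: cvgM; first exact: cvg_cst.
  by rewrite expr2; under eq_fun do rewrite expr2; exact: cvgM.
apply: (ler_cvg_to h1 h2); apply: nearW => n.
rewrite comb_ip re_sum (comb_nrm 0 n (fun k => ip x (u k))) mulr_sumr.
apply: ler_sum => k kd; rewrite Ta // mulrCA re_embM mulrC [cj _ * _]mulrC -nrm_sqr re_emb.
rewrite [leLHS]mulrC; have [x0|x0] := eqVneq (ip x (u k)) 0.
  by rewrite x0 nrm0 expr0n /= !mulr0.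
by rewrite ler_wpM2r ?exprn_ge0 ?nrm_ge0 // ab.
Qed.

End Diag.

Lemma is_diagN T a : is_diag T a -> is_diag (fun x => - T x) (fun k => - a k).
Proof. by move=> Ta x k kd; rewrite ipNl Ta // rmorphN mulNr. Qed.

Lemma is_diagD T a T' a' : is_diag T a -> is_diag T' a' ->
  is_diag (fun x => T x + T' x) (fun k => a k + a' k).
Proof. by move=> Ta T'a x k kd; rewrite ipDl Ta // T'a // rmorphD mulrDl. Qed.

Lemma is_diagZ c T a : is_diag T a ->
  is_diag (fun x => e c *: T x) (fun k => c * a k).
Proof. by move=> Ta x k kd; rewrite ipZl Ta // rmorphM mulrA. Qed.

Lemma is_diag_comp T a T' a' : is_diag T a -> is_diag T' a' ->
  is_diag (T \o T') (fun k => a k * a' k).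
Proof. by move=> Ta T'a x k kd; rewrite /= Ta // T'a // rmorphM mulrA. Qed.

Lemma is_diag_iter T a n : is_diag T a -> is_diag (iter n T) (fun k => a k ^+ n).
Proof.
move=> Ta x k kd; elim: n x => [|n IH] x; first by rewrite expr0 rmorph1 mul1r.
by rewrite iterS Ta // IH exprS rmorphM mulrA.
Qed.

Lemma is_diag_proj j : in_dim d j ->
  is_diag (eig_proj ip u j) (fun k => (k == j)%:R).
Proof.
move=> jd x k kd; rewrite /eig_proj /tensor ipZl onb_ip // eq_sym.
by have [->|_] := eqVneq k j; rewrite ?rmorph1 ?rmorph0 ?mul1r ?mulr1 ?mul0r ?mulr0.
Qed.

Lemma is_diag_form_ge T a (b : R) x : is_diag T a ->
  (forall k, in_dim d k -> ip x (u k) != 0 -> b <= a k) ->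
  b * N x ^+ 2 <= re F (ip (T x) x).
Proof.
move=> /is_diagN Ta ab.
have := is_diag_form_le Ta (b := - b) (x := x).
rewrite ipNl reN mulNr lerN2; apply => k kd xk.
by rewrite lerN2 ab.
Qed.

End Basis.

(** * Hilbert-Schmidt bounds, rank-one operators and partial traces *)

Section HilbertSchmidt.
Context (R : realType) (K : numFieldType) (F : scalars R K).
Context (H : completeNormedModType K) (ip : {dot H for conj F}).
Context (ip_norm : norm_from_dot ip).
Context (d : option nat) (u : nat -> H) (u_onb : orthonormal_basis ip d u).
Local Notation e := (emb F).
Local Notation N := (nrm F).
Implicit Types x y z v w : H.
Implicit Types T : H -> H.

(** A Hilbert-Schmidt bound through finite partial sums, which keeps the estimates in [R];
    [hs_le_hsnorm] converts it to the extended-real norm. *)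
Definition hs_le T (B : R) :=
  forall n, \sum_(0 <= k < n | in_dim d k) N (T (u k)) ^+ 2 <= B ^+ 2.

Lemma hs_le_eq T T' B : T =1 T' -> hs_le T B -> hs_le T' B.
Proof. by move=> TT h n; under eq_bigr do rewrite -TT. Qed.

Lemma hs_leS T B B' : 0 <= B <= B' -> hs_le T B -> hs_le T B'.
Proof.
move=> /andP[B0 BB] h n; apply: le_trans (h n) _.
by rewrite ler_pXn2r ?nnegrE // (le_trans B0).
Qed.

Lemma hs_leZ T B c : nrm F c = 1 -> hs_le T B ->
  hs_le (fun x => c *: T x) B.
Proof. by move=> c1 h n; under eq_bigr do rewrite nrmZ c1 mul1r. Qed.

(** Termwise (a + b)^2 <= (1 + t) a^2 + (1 + 1/t) b^2; the choice t = B'/B makes the resulting total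
    exactly (B + B')^2. *)
Lemma hs_leD T T' B B' : 0 < B -> 0 < B' -> hs_le T B -> hs_le T' B' ->
  hs_le (fun x => T x + T' x) (B + B').
Proof.
move=> B0 B'0 h h' n.
pose t := B' / B.
have t0 : 0 < t by rewrite divr_gt0.
apply: le_trans (_ : \sum_(0 <= k < n | in_dim d k)
    ((1 + t) * N (T (u k)) ^+ 2 + (1 + t^-1) * N (T' (u k)) ^+ 2) <= _).
  apply: ler_sum => k _; set a := N (T _); set b := N (T' _).
  have a0 : 0 <= a by exact: nrm_ge0.
  have b0 : 0 <= b by exact: nrm_ge0.
  apply: le_trans (_ : (a + b) ^+ 2 <= _).
    by rewrite ler_pXn2r ?nnegrE ?addr_ge0 ?nrm_ge0 // nrmD.
  rewrite -subr_ge0 [leRHS](_ : _ = t^-1 * (t * a - b) ^+ 2); last first.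
    by field; rewrite gt_eqF.
  by rewrite mulr_ge0 ?invr_ge0 ?(ltW t0) ?sqr_ge0.
rewrite big_split /= -!mulr_sumr.
apply: le_trans (_ : (1 + t) * B ^+ 2 + (1 + t^-1) * B' ^+ 2 <= _).
  by rewrite lerD // ler_wpM2l ?addr_ge0 ?invr_ge0 ?(ltW t0).
by rewrite le_eqVlt; apply/orP; left; apply/eqP; rewrite /t; field; rewrite !gt_eqF.
Qed.

(** One-element lists form a base case of their own: [hs_leD] wants positive bounds, and the empty
    sum has bound 0. *)
Lemma hs_le_sum (I : eqType) (s : seq I) (T : I -> H -> H) (B : I -> R) :
  (forall i, 0 < B i) -> (forall i, i \in s -> hs_le (T i) (B i)) ->
  hs_le (fun x => \sum_(i <- s) T i x) (\sum_(i <- s) B i).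
Proof.
move=> B0; elim: s => [_ n|i [_ h|i' s IH h]].
- by rewrite big1 ?big_nil ?expr0n // => k _; rewrite big_nil nrm0 expr0n.
- by apply: (@hs_le_eq (T i)) => [x|]; rewrite big_seq1 //; apply: h; rewrite mem_head.
- apply: (@hs_le_eq (fun x => T i x + \sum_(i <- i' :: s) T i x)) => [x|].
    by rewrite [RHS]big_cons.
  rewrite big_cons; apply: hs_leD => //.
  + by rewrite big_cons ltr_wpDr // sumr_ge0 // => k _; rewrite ltW.
  + by apply: h; rewrite mem_head.
  + by apply: IH => k ks; apply: h; rewrite inE ks orbT.
Qed.

Lemma hs_le_hsnorm T B : 0 <= B -> hs_le T B -> (hsnorm F d u T <= B%:E)%E.
Proof.
move=> B0 h; rewrite /hsnorm.
have -> : (B%:E = sqrte ((B ^+ 2)%:E))%E by rewrite /= sqrtr_sqr ger0_norm.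
rewrite lee_sqrt ?lee_fin ?sqr_ge0 //.
apply: lime_le; first by apply: is_cvg_nneseries => k _ _; rewrite lee_fin sqr_ge0.
by apply: nearW => n; rewrite sumEFin lee_fin; exact: h.
Qed.

Lemma hsnorm_ge T l : in_dim d l -> ((N (T (u l)))%:E <= hsnorm F d u T)%E.
Proof.
move=> ld; rewrite /hsnorm.
have -> : ((N (T (u l)))%:E = sqrte ((N (T (u l)) ^+ 2)%:E))%E.
  by rewrite /= sqrtr_sqr ger0_norm ?nrm_ge0.
rewrite lee_sqrt; last by apply: nneseries_ge0 => k _ _; rewrite lee_fin sqr_ge0.
apply: le_trans (nneseries_lim_ge l.+1 _); last by move=> k _ _; rewrite lee_fin sqr_ge0.
rewrite big_mkcond big_nat_recr //= ld leeDr // sume_ge0 // => k _.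
by case: ifP => _ //; rewrite lee_fin sqr_ge0.
Qed.

Lemma opnorm_bound T (B : R) : linear T -> (opnorm F T <= B%:E)%E ->
  forall x, N (T x) <= B * N x.
Proof.
move=> Tl TB x.
have [->|x0] := eqVneq x 0; first by rewrite (lin0 Tl) !nrm0 mulr0.
have n0 : 0 < N x by rewrite lt0r nrm_eq0 x0 nrm_ge0.
pose y := e (N x)^-1 *: x.
have y1 : `|y| <= 1.
  by rewrite -(emb_nrm F) nrmZ nrm_emb gtr0_norm ?invr_gt0 // mulVf ?gt_eqF // rmorph1.
have : ((rnorm F (T y))%:E <= B%:E)%E.
  by apply: le_trans TB; apply: ereal_sup_ubound; exists y.
rewrite lee_fin -[rnorm F _]/(N (T y)) (linZ Tl) nrmZ nrm_emb gtr0_norm ?invr_gt0 //.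
by rewrite mulrC ler_pdivrMr.
Qed.

Lemma tensor_nrm v w x : N (tensor ip v w x) = nrm F (ip x w) * N v.
Proof. by rewrite nrmZ. Qed.

Lemma tensor_hs_le v w : hs_le (tensor ip v w) (N v * N w).
Proof.
move=> n; under eq_bigr do rewrite tensor_nrm exprMn mulrC ipC nrm_conj.
by rewrite -mulr_sumr exprMn ler_wpM2l ?sqr_ge0 ?(bessel ip_norm u_onb).
Qed.

(** The operator norm of a rank-one operator is attained at [w]. It equals the Hilbert-Schmidt norm
    and dominates the partial traces, so operator bounds of rank-one words transfer to both. *)
Lemma tensor_nrm_le v w (B : R) : 0 <= B ->
  (forall x, N (tensor ip v w x) <= B * N x) -> N v * N w <= B.
Proof.
move=> B0 /(_ w); have [->|w0] := eqVneq w 0; first by rewrite !nrm0 !mulr0.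
rewrite tensor_nrm (ip_sqr ip_norm) nrm_emb ger0_norm ?sqr_ge0 //.
rewrite [leLHS](_ : _ = N v * N w * N w); last by ring.
by rewrite ler_pM2r // lt0r nrm_eq0 w0 nrm_ge0.
Qed.

Definition ptrace T n := \sum_(0 <= k < n | in_dim d k) ip (T (u k)) (u k).

Lemma tensor_ptrace v w n : ptrace (tensor ip v w) n = ip (proj_range ip d u 0 n v) w.
Proof.
by rewrite ip_suml; apply: eq_bigr => k _; rewrite !ipZl mulrC.
Qed.

Lemma tensor_ptrace_le v w n : nrm F (ptrace (tensor ip v w) n) <= N v * N w.
Proof.
rewrite tensor_ptrace; apply: le_trans (nrm_ip_le ip_norm _ _) _.
by rewrite ler_wpM2r ?nrm_ge0 // (proj_range_le ip_norm u_onb).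
Qed.

Lemma tensor_ptrace_cvg v w :
  (ptrace (tensor ip v w) n : K^o) @[n --> \oo] --> (ip v w : K^o).
Proof.
under eq_fun do rewrite tensor_ptrace.
by apply: (cvg_ipl ip_norm (y := w)); apply: (proj_range_cvg u_onb).
Qed.

End HilbertSchmidt.

(** * Courant-Fischer inequalities *)

Section MinMax.
Context (R : realType) (K : numFieldType) (F : scalars R K).
Context (H : completeNormedModType K) (ip : {dot H for conj F}).
Context (ip_norm : norm_from_dot ip) (d : option nat).
Local Notation N := (nrm F).

Lemma in_dim_leq k l : in_dim d k -> (0 < l <= k)%N -> in_dim d l.
Proof.
rewrite /in_dim; case: d => [m|] /andP[_ kd] /andP[-> lk] //.
exact: leq_trans lk kd.
Qed.

(** Dimension count: a combination of the first k + 1 vectors of [p] has to meet k linear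
    conditions, and a matrix with k + 1 rows and k columns has a nonzero left kernel. *)
Lemma exists_orthogonal (p q : nat -> H) k :
  orthonormal_basis ip d p -> in_dim d k.+1 ->
  exists x, [/\ x != 0,
    forall l, in_dim d l -> (k.+1 < l)%N -> ip x (p l) = 0 &
    forall l, in_dim d l -> (l < k.+1)%N -> ip x (q l) = 0].
Proof.
move=> p_onb kd.
pose M : 'M[K]_(k.+1, k) := \matrix_(i, l) ip (p i.+1) (q l.+1).
have : kermx M != 0.
  rewrite -mxrank_eq0 mxrank_ker subn_eq0 -ltnNge ltnS; exact: rank_leq_col.
case/rowV0Pn => v /sub_kermxP vM v0.
(* Basis indices start at 1 and matrix indices at 0; index 0 is filtered out of the sum by
   [in_dim]. *)
pose c i := v 0 (inord i.-1 : 'I_k.+1).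
pose x := \sum_(0 <= i < k.+2 | in_dim d i) c i *: p i.
have xE : x = \sum_(i < k.+1) v 0 i *: p i.+1.
  rewrite /x big_mkcond big_nat_recl //= add0r big_mkord.
  apply: eq_bigr => i _; rewrite (in_dim_leq kd) /= ?ltn_ord //.
  by rewrite /c /= inord_val.
exists x; split.
- case/rV0Pn: v0 => i vi0; apply: contraNneq vi0 => x0.
  have id : in_dim d i.+1 by apply: (in_dim_leq kd); rewrite /= ltn_ord.
  have := comb_coord p_onb 0 k.+2 c id; rewrite -/x x0 ip0l /= ltnS ltn_ord.
  by rewrite /c /= inord_val => <-.
- by move=> l ld kl; rewrite comb_coord // (ltnNge l) kl andbF.
- case=> [|l] ld // lk; rewrite xE ip_suml.
  have := congr1 (fun A : 'rV_k => A 0 (Ordinal (lk : (l < k)%N))) vM.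
  rewrite /= !mxE => h; rewrite -[RHS]h; apply: eq_bigr => i _; by rewrite mxE ipZl.
Qed.

Context (u uh : nat -> H).
Context (u_onb : orthonormal_basis ip d u) (uh_onb : orthonormal_basis ip d uh).
Context (Sh : H -> H) (lamh : nat -> R) (Sh_diag : is_diag ip d uh Sh lamh).
Context (lamh_mon : forall k l, in_dim d k -> in_dim d l -> (k <= l)%N ->
  lamh l <= lamh k).

(** Some nonzero vector in the span of [uh 1], ..., [uh k] is orthogonal to the first k - 1 vectors
    of [u]; there the form of [Sh] is at least [lamh k] times the squared norm. *)
Lemma minmax_le k (b : R) : in_dim d k ->
  (forall x, (forall l, in_dim d l -> (l < k)%N -> ip x (u l) = 0) ->
     re F (ip (Sh x) x) <= b * N x ^+ 2) ->
  lamh k <= b.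
Proof.
case: k => // k kd h; have [x [x0 xp xq]] := exists_orthogonal u uh_onb kd.
have n0 : 0 < N x ^+ 2 by rewrite exprn_gt0 // lt0r nrm_eq0 x0 nrm_ge0.
rewrite -(ler_pM2r n0); apply: le_trans (h _ xq).
apply: (is_diag_form_ge ip_norm uh_onb Sh_diag) => l ld.
by apply: contraR; rewrite -ltNge => xl; rewrite xp // ltnNge; apply: contraTN xl => lk;
  rewrite -leNgt lamh_mon.
Qed.

(** The two bases exchange roles: the test vector lies in the span of [u 1], ..., [u k] and is
    orthogonal to the first k - 1 vectors of [uh]. *)
Lemma minmax_ge k (b : R) : in_dim d k ->
  (forall x, (forall l, in_dim d l -> (k < l)%N -> ip x (u l) = 0) ->
     b * N x ^+ 2 <= re F (ip (Sh x) x)) ->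
  b <= lamh k.
Proof.
case: k => // k kd h; have [x [x0 xp xq]] := exists_orthogonal uh u_onb kd.
have n0 : 0 < N x ^+ 2 by rewrite exprn_gt0 // lt0r nrm_eq0 x0 nrm_ge0.
rewrite -(ler_pM2r n0); apply: le_trans (h _ xp) _.
apply: (is_diag_form_le ip_norm uh_onb Sh_diag) => l ld.
by apply: contraR; rewrite -ltNge => xl; rewrite xq // ltnNge; apply: contraTN xl => lk;
  rewrite -leNgt lamh_mon.
Qed.

End MinMax.

(** * Enumeration of the exponent sequences *)

Section Compositions.

Definition inc_head (s : seq nat) : seq nat :=
  if s is k :: s' then k.+1 :: s' else [::].

(* The sequences of [n.+1] naturals of sum [m].  The recursion is Pascal's, on
   whether the first entry is zero: it matches the action of [S - lam j] on the
   leftmost factor of a resolvent word. *)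
Fixpoint comps (n : nat) : nat -> seq (seq nat) :=
  if n is n'.+1 then
    fix aux m := if m is m'.+1
      then [seq 0%N :: s | s <- comps n' m] ++ [seq inc_head s | s <- aux m']
      else [seq 0%N :: s | s <- comps n' 0]
  else fun m => [:: [:: m]].

Lemma compsSS n m : comps n.+1 m.+1 =
  [seq 0%N :: s | s <- comps n m.+1] ++ [seq inc_head s | s <- comps n.+1 m].
Proof. by []. Qed.

Lemma compsS0 n : comps n.+1 0 = [seq 0%N :: s | s <- comps n 0].
Proof. by []. Qed.

Lemma mem_map_cons0 k s (l : seq (seq nat)) :
  (k :: s \in [seq 0%N :: t | t <- l]) = (k == 0%N) && (s \in l).
Proof.
apply/mapP/andP => [[t tl [-> ->]] //|[/eqP -> sl]]; by exists s.
Qed.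

Lemma mem_map_inc_head k s (l : seq (seq nat)) :
  (k :: s \in map inc_head l) = (0 < k)%N && (k.-1 :: s \in l).
Proof.
apply/mapP/andP => [[[|k' t] tl] // [-> ->] //|[k0 sl]].
by exists (k.-1 :: s); rewrite //= prednK.
Qed.

Lemma mem_comps n m s : (s \in comps n m) = (size s == n.+1) && (sumn s == m).
Proof.
elim: n m s => [|n IHn] m s.
  rewrite inE; case: s => [|k [|k' s]]; rewrite ?eqseq_cons ?andbF //=.
  by rewrite addn0 andbT.
elim: m s => [|m IHm] s.
  rewrite compsS0; case: s => [|k s]; first by apply/negP => /mapP[].
  rewrite mem_map_cons0 IHn /= eqSS addn_eq0.
  by case: (size s == _) => //=; rewrite andbF.
rewrite compsSS mem_cat; case: s => [|k s].
  by apply/negP; case/orP => /mapP[] // [|k s] //; rewrite IHm.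
rewrite mem_map_cons0 mem_map_inc_head IHn IHm /= !eqSS.
by case: k => [|k] /=; rewrite ?orbF // addSn eqSS.
Qed.

Lemma inc_head_inj : injective inc_head.
Proof. by move=> [|k s] [|l t] //= [-> ->]. Qed.

Lemma uniq_comps n m : uniq (comps n m).
Proof.
elim: n m => [|n IHn] m; first by [].
have h k : uniq [seq 0%N :: s | s <- comps n k] by rewrite map_inj_uniq // => s t [].
elim: m => [|m IHm]; first exact: h.
rewrite compsSS cat_uniq h map_inj_uniq ?IHm //=; last exact: inc_head_inj.
rewrite andbT; apply/hasPn => -[|k s] /=; first by move=> _; apply/negP => /mapP[].
by rewrite mem_map_inc_head mem_map_cons0 => /andP[]; case: k.
Qed.

(** Pascal's recursion at most doubles the count at each step. For m = n this bound is 4^n, the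
    origin of the ratio 4 delta. *)
Lemma size_comps n m : (size (comps n m) <= 2 ^ (n + m))%N.
Proof.
elim: n m => [|n IHn] m; first by rewrite /= expn_gt0.
elim: m => [|m IHm].
  rewrite compsS0 size_map (leq_trans (IHn _)) // leq_exp2l // leq_add2r //.
rewrite compsSS size_cat !size_map addnS expnS mul2n -addnn.
by rewrite leq_add // (leq_trans (IHn _)) // addnS addSn.
Qed.

(** Taking the adjoint reverses a word, so this symmetry is what makes the word sums
    self-adjoint. *)
Lemma perm_rev_comps n m : perm_eq (map rev (comps n m)) (comps n m).
Proof.
apply: uniq_perm; rewrite ?uniq_comps //.
  by rewrite map_inj_uniq ?uniq_comps //; apply: can_inj revK.
move=> s; rewrite -{1}(revK s) mem_map; last exact: can_inj revK.
by rewrite !mem_comps size_rev sumn_rev.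
Qed.

(** Only the first half of Pascal's recursion starts with 0. The nonzero default of [head] sends the
    empty sequence to the other branch. *)
Lemma sum_comps_head0 (V : nmodType) n m (f : seq nat -> V) :
  \sum_(s <- comps n.+1 m) (if head 1%N s == 0%N then f (behead s) else 0) =
  \sum_(s <- comps n m) f s.
Proof.
case: m => [|m]; first by rewrite compsS0 big_map.
rewrite compsSS big_cat !big_map /= [X in _ + X]big1 ?addr0 // => -[|k s] _ //.
Qed.

(** Pigeonhole: when m <= n, every word of [word_sum n m] has a zero exponent, hence a rank-one
    factor. *)
Lemma has0_of_sumn_lt_size s : (sumn s < size s)%N -> 0%N \in s.
Proof.
elim: s => // -[|k] s IH /=; first by rewrite inE eqxx.
by rewrite inE /= addSn ltnS => h; apply: IH; rewrite (leq_ltn_trans _ h) ?leq_addl.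
Qed.

(** Entries of a sequence of sum [n] are at most [n] and so fit in ['I_n.+1]: the tuples in
    [proj_term] and the recursive lists enumerate the same sequences. *)
Lemma sum_tuples_comps (V : nmodType) n (f : seq nat -> V) :
  \sum_(k : n.+1.-tuple 'I_n.+1 | (\sum_(i <- k) i == n)%N)
     f [seq nat_of_ord i | i <- k] =
  \sum_(s <- comps n n) f s.
Proof.
rewrite -big_filter -(big_map (fun k : n.+1.-tuple 'I_n.+1 => map val k) predT f).
apply: perm_big; apply: uniq_perm; rewrite ?uniq_comps //.
  rewrite map_inj_uniq ?filter_uniq ?index_enum_uniq //.
  move=> s t /(inj_map val_inj) st; exact: val_inj.
move=> s; rewrite mem_comps; apply/mapP/andP.
  move=> [k]; rewrite mem_filter => /andP[/eqP kn _] ->.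
  by rewrite size_map size_tuple eqxx sumnE big_map kn eqxx.
move=> [/eqP ss /eqP sn].
have sb : all (fun i => (i < n.+1)%N) s.
  apply/allP => i /perm_to_rem /perm_sumn; rewrite sn ltnS /= => ->.
  exact: leq_addr.
have st : size [seq (inord i : 'I_n.+1) | i <- s] == n.+1 by rewrite size_map ss.
have sE : s = [seq val i | i <- Tuple st].
  rewrite /= -map_comp -[LHS]map_id; apply/eq_in_map => i /(allP sb) ilt.
  by rewrite /= inordK.
exists (Tuple st) => //.
rewrite mem_filter mem_index_enum andbT; apply/eqP.
by rewrite -[RHS]sn [in RHS](congr1 sumn sE) sumnE big_map.
Qed.

End Compositions.

(** * Algebra and norm bounds of resolvent words *)

Section Words.
Context (R : realType) (K : numFieldType) (F : scalars R K).
Context (H : completeNormedModType K) (ip : {dot H for conj F}).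
Context (ip_norm : norm_from_dot ip).
Context (d : option nat) (u : nat -> H) (u_onb : orthonormal_basis ip d u).
Context (lam : nat -> R) (j : nat) (jd : in_dim d j).
Context (g : R) (g_gt0 : 0 < g).
Context (lam_gap : forall k, in_dim d k -> k != j -> g <= `|lam k - lam j|).
Context (E : H -> H) (E_sa : self_adjoint ip E).
Context (D : H -> H) (D_diag : is_diag ip d u D (fun k => lam k - lam j)).
Local Notation e := (emb F).
Local Notation N := (nrm F).
Local Notation res := (resolvent ip d u lam j).
Local Notation A0 := (abs_resolvent_sqrt ip d u lam j).
Local Notation rp := (res_pow ip d u lam j).
Local Notation word := (res_word ip d u lam j E).
Local Notation gs := (Num.sqrt g).
Implicit Types x y z v w : H.

Lemma sqrt_gap_gt0 : 0 < gs.
Proof. by rewrite sqrtr_gt0. Qed.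

Lemma gap_neq0 k : in_dim d k -> k != j -> lam k - lam j != 0.
Proof. by move=> kd /(lam_gap kd) h; rewrite -normr_gt0 (lt_le_trans g_gt0). Qed.

Let E_lin : linear E := adjoint_linear ip_norm E_sa.
Let D_lin : linear D := is_diag_linear ip_norm u_onb D_diag.

Lemma resolvent_diag :
  is_diag ip d u res (fun k => if k == j then 0 else (lam k - lam j)^-1).
Proof.
apply: (diag_op_is_diag ip_norm u_onb (M := g^-1)) => k kd.
case: ifPn => [_|kj]; first by rewrite normr0 invr_ge0 ltW.
by rewrite normfV lef_pV2 ?posrE ?normr_gt0 ?gap_neq0 ?lam_gap.
Qed.

Lemma abs_resolvent_sqrt_coef_le k : in_dim d k ->
  `|if k == j then 0 else (Num.sqrt `|lam k - lam j|)^-1| <= gs^-1.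
Proof.
move=> kd; case: ifPn => [_|kj]; first by rewrite normr0 invr_ge0 sqrtr_ge0.
rewrite ger0_norm ?invr_ge0 ?sqrtr_ge0 //.
rewrite lef_pV2 ?posrE ?sqrtr_gt0 ?normr_gt0 ?gap_neq0 //.
by rewrite ler_wsqrtr // lam_gap.
Qed.

Lemma abs_resolvent_sqrt_diag : is_diag ip d u A0
  (fun k => if k == j then 0 else (Num.sqrt `|lam k - lam j|)^-1).
Proof.
exact: (diag_op_is_diag ip_norm u_onb abs_resolvent_sqrt_coef_le).
Qed.

Let A0_sa : self_adjoint ip A0 :=
  is_diag_self_adjoint ip_norm u_onb abs_resolvent_sqrt_diag.
Let A0_lin : linear A0 := is_diag_linear ip_norm u_onb abs_resolvent_sqrt_diag.

Lemma abs_resolvent_sqrt_le x : N (A0 x) <= gs^-1 * N x.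
Proof.
apply: (is_diag_bounded ip_norm u_onb abs_resolvent_sqrt_diag).
  by rewrite invr_ge0 sqrtr_ge0.
exact: abs_resolvent_sqrt_coef_le.
Qed.

Lemma res_pow_diag n : is_diag ip d u (rp n)
  (fun k => if n == 0%N then - (k == j)%:R
            else (if k == j then 0 else (lam k - lam j)^-1) ^+ n).
Proof.
rewrite /res_pow; case: ifP => _; first exact/is_diagN/is_diag_proj.
exact/is_diag_iter/resolvent_diag.
Qed.

Lemma res_pow_self_adjoint n : self_adjoint ip (rp n).
Proof. exact: (is_diag_self_adjoint ip_norm u_onb (res_pow_diag n)). Qed.

Lemma res_pow_linear n : linear (rp n).
Proof. exact: (is_diag_linear ip_norm u_onb (res_pow_diag n)). Qed.

Lemma res_pow0 x : rp 0 x = - (ip x (u j) *: u j).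
Proof. by []. Qed.

Lemma D_res_pow0 x : D (rp 0 x) = 0.
Proof.
apply: (onb_ext u_onb) => k kd; rewrite D_diag // res_pow_diag // ip0l /=.
by have [->|_] := eqVneq k j; rewrite ?subrr ?oppr0 rmorph0 ?mul0r ?mulr0.
Qed.

(** D inverts R_j off P_j, so it lowers the exponent by one. At [n = 0], D R = 1 - P_j and R^(0) = -
    P_j, which leaves the identity as the only correction. *)
Lemma D_res_powS n x :
  D (rp n.+1 x) = rp n x + (if n == 0%N then x else 0).
Proof.
apply: (onb_ext u_onb) => k kd; rewrite D_diag // ipDl !res_pow_diag //=.
have [->|kj] := eqVneq k j.
  rewrite subrr rmorph0 mul0r; case: n => [|n] /=.
    by rewrite rmorphN rmorph1 mulN1r addNr.
  by rewrite exprS mul0r rmorph0 mul0r ip0l addr0.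
rewrite mulrA -rmorphM exprS mulrA divff ?gap_neq0 // mul1r.
by case: n => [|n] /=; rewrite ?oppr0 ?rmorph0 ?expr0 ?rmorph1 ?mul1r ?mul0r ?add0r ?ip0l ?addr0.
Qed.

Lemma word_cons k s x : s != [::] -> word (k :: s) x = rp k (E (word s x)).
Proof. by case: s. Qed.

Lemma word_rcons s k x : s != [::] -> word (rcons s k) x = word s (E (rp k x)).
Proof.
elim: s => // k0 [|k1 s] IH _ //.
by rewrite rcons_cons word_cons // IH.
Qed.

Lemma word_adjoint s x y : ip (word s x) y = ip x (word (rev s) y).
Proof.
elim: s x y => // k [|k1 s] IH x y; first exact: res_pow_self_adjoint.
rewrite word_cons // res_pow_self_adjoint E_sa IH (rev_cons k) word_rcons //.
by rewrite -size_eq0 size_rev.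
Qed.

(* A word with a zero exponent contains the rank-one factor [- P_j]. *)
Lemma word_rank_one s : 0%N \in s ->
  exists v w, forall x, word s x = tensor ip v w x.
Proof.
elim: s => // k [|k1 s] IH.
  by rewrite inE => /eqP <-; exists (- u j), (u j) => x; rewrite /tensor scalerN.
rewrite inE; have [s0 _|_] := boolP (0%N \in k1 :: s).
  have [v [w vw]] := IH s0; exists (rp k (E v)), w => x.
  by rewrite word_cons // vw /tensor (linZ E_lin) (linZ (res_pow_linear k)).
rewrite orbF => /eqP <-; exists (- u j), (word (rev (k1 :: s)) (E (u j))) => x.
by rewrite word_cons // res_pow0 E_sa word_adjoint /tensor scalerN.
Qed.

Definition word_sum n m x : H := \sum_(s <- comps n m) word s x.
Local Notation W := word_sum.

Lemma proj_termE n x : proj_term ip d u lam j E n x = (-1) ^+ n.+1 *: W n n x.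
Proof. by rewrite /proj_term (sum_tuples_comps n (fun s => word s x)). Qed.

Lemma word_sum_self_adjoint n m : self_adjoint ip (W n m).
Proof.
move=> x y; rewrite ip_suml ip_sumr -(perm_big _ (perm_rev_comps n m)) big_map.
by apply: eq_bigr => s _; rewrite word_adjoint revK.
Qed.

Lemma word_sum_linear n m : linear (W n m).
Proof. exact: (adjoint_linear ip_norm (@word_sum_self_adjoint n m)). Qed.

Lemma D_word_sum_n0 n x : D (W n 0 x) = 0.
Proof.
case: n => [|n]; first by rewrite /W big_seq1 D_res_pow0.
rewrite /W compsS0 big_map (lin_sum D_lin) big_seq big1 // => s.
by rewrite mem_comps => /andP[ss _]; rewrite word_cons ?D_res_pow0 // -size_eq0 (eqP ss).
Qed.

Lemma D_word_sum_0S m x :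
  D (W 0 m.+1 x) = W 0 m x + (if m == 0%N then x else 0).
Proof. by rewrite /W !big_seq1 D_res_powS. Qed.

(** [D] kills the words starting with R^(0) and lowers the first exponent of the others. Where that
    exponent drops to 0, the identity in [D_res_powS] strips the first factor and leaves [E] times a
    shorter word. *)
Lemma D_word_sum n m x : D (W n.+1 m.+1 x) = W n.+1 m x + E (W n m x).
Proof.
rewrite /W compsSS big_cat !big_map (linD D_lin) !(lin_sum D_lin).
rewrite big_seq big1 ?add0r; last first.
  move=> s; rewrite mem_comps => /andP[ss _].
  by rewrite word_cons ?D_res_pow0 // -size_eq0 (eqP ss).
rewrite (lin_sum E_lin) -(sum_comps_head0 n m (fun s => E (word s x))) -big_split.
rewrite big_seq [RHS]big_seq; apply: eq_bigr => -[|k s]; rewrite mem_comps //.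
move=> /andP[/eqP[ss] _]; have s0 : s != [::] by rewrite -size_eq0 ss.
rewrite [inc_head _]/= !word_cons // D_res_powS.
by case: ifP.
Qed.

(** The adjoint of [D_word_sum]; it serves the term tr(P_n R_j^(-1)), where [D] acts from the
    right. *)
Lemma word_sum_D n m x : W n.+1 m.+1 (D x) = W n.+1 m x + W n m (E x).
Proof.
apply: (onb_ext u_onb) => k _.
rewrite word_sum_self_adjoint (is_diag_self_adjoint ip_norm u_onb D_diag).
rewrite D_word_sum ipDr ipDl; congr (_ + _); first by rewrite word_sum_self_adjoint.
by rewrite word_sum_self_adjoint E_sa.
Qed.

Section Bounds.
Context (delta : R) (delta_gt0 : 0 < delta).
Context (EAA : forall x, N (A0 (E (A0 x))) <= delta * N x).
Context (EAP : N (A0 (E (u j))) <= delta * gs).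
Context (EPP : nrm F (ip (E (u j)) (u j)) <= delta * g).

(* [balanced w B] says that [w = A y] with [|y| <= B], where
   [A = |R_j|^(1/2) + g^(-1/2) P_j] and [y] lies either in the range of [P_j]
   or in its orthogonal complement.  Each block of [A E A] is bounded by
   [delta]. *)
Definition balanced w (B : R) :=
  (exists2 c : K, w = c *: u j & nrm F c * gs <= B) \/
  (exists2 y, w = A0 y & N y <= B).

Lemma gsK : gs * gs = g.
Proof. by rewrite -expr2 sqr_sqrtr // ltW. Qed.

Lemma balanced_le w B : balanced w B -> N w <= B / gs.
Proof.
case=> [[c ->]|[y ->]] h.
  by rewrite nrmZ (onb_nrm ip_norm u_onb) // mulr1 ler_pdivlMr ?sqrt_gap_gt0.
rewrite (le_trans (abs_resolvent_sqrt_le _)) // mulrC.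
by rewrite ler_wpM2r // invr_ge0 sqrtr_ge0.
Qed.

Lemma balanced_E w B : balanced w B ->
  nrm F (ip (E w) (u j)) <= gs * (delta * B) /\ N (A0 (E w)) <= delta * B.
Proof.
have gs0 := sqrt_gap_gt0.
case=> [[c ->]|[y ->]] h.
  rewrite (linZ E_lin) ipZl nrmM (linZ A0_lin) nrmZ; split.
    apply: le_trans (ler_wpM2l (nrm_ge0 _ _) EPP) _.
    rewrite -{1}gsK [leLHS](_ : _ = gs * (delta * (nrm F c * gs))); last by ring.
    by rewrite !ler_wpM2l ?(ltW delta_gt0) ?(ltW gs0).
  apply: le_trans (ler_wpM2l (nrm_ge0 _ _) EAP) _.
  by rewrite mulrCA ler_wpM2l ?(ltW delta_gt0).
split.
  (* This block of A E A is the adjoint of the one controlled by [EAP]. *)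
  rewrite E_sa A0_sa; apply: le_trans (nrm_ip_le ip_norm _ _) _.
  apply: le_trans (ler_pM (nrm_ge0 _ _) (nrm_ge0 _ _) h EAP) _.
  by rewrite le_eqVlt; apply/orP; left; apply/eqP; ring.
apply: le_trans (EAA y) _.
by rewrite ler_wpM2l ?(ltW delta_gt0).
Qed.

Lemma balanced_res_pow k v B :
  nrm F (ip v (u j)) <= gs * B -> N (A0 v) <= B ->
  balanced (rp k v) (g / g ^+ k * B).
Proof.
have gs0 := sqrt_gap_gt0.
case: k => [|k] h1 h2.
  (* Exponent 0: R^(0) = A M_0 A with M_0 = - g P_j. *)
  left; exists (- ip v (u j)); first by rewrite res_pow0 scaleNr.
  by rewrite nrmN expr0 divr1 -[g in g * B]gsK -mulrA mulrC ler_wpM2l ?(ltW gs0).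
right.
(* The diagonal of M_(k+1): the two outer factors [A0] contribute |lam_l - lam_j|^(-1), which the
   numerator compensates. *)
pose m l := if l == j then 0 else `|lam l - lam j| / (lam l - lam j) ^+ k.+1.
have m_le l : in_dim d l -> `|m l| <= g / g ^+ k.+1.
  move=> ld; rewrite /m; case: ifPn => [_|lj].
    by rewrite normr0 divr_ge0 ?exprn_ge0 ?ltW.
  have n0 : 0 < `|lam l - lam j| by rewrite normr_gt0 gap_neq0.
  rewrite normrM normfV normrX normr_id !exprS !invfM !mulrA !divff ?gt_eqF // !mul1r.
  by rewrite lef_pV2 ?posrE ?exprn_gt0 // lerXn2r ?nnegrE ?(ltW g_gt0) ?(ltW n0) // lam_gap.
have m_diag := diag_op_is_diag ip_norm u_onb m_le.
exists (diag_op ip d u m (A0 v)).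
  apply: (onb_ext u_onb) => l ld.
  rewrite res_pow_diag // !abs_resolvent_sqrt_diag // m_diag //.
  rewrite abs_resolvent_sqrt_diag // !mulrA -!rmorphM; congr (e _ * _).
  rewrite /m; case: ifPn => [_|lj]; first by rewrite exprS !mul0r.
  have n0 : 0 < Num.sqrt `|lam l - lam j| by rewrite sqrtr_gt0 normr_gt0 gap_neq0.
  rewrite /= exprVn -{2}(sqr_sqrtr (normr_ge0 (lam l - lam j))); field.
  by rewrite gt_eqF // expf_neq0 // gap_neq0.
apply: le_trans (is_diag_bounded ip_norm u_onb m_diag _ m_le _) _.
  by rewrite divr_ge0 ?exprn_ge0 ?ltW.
by rewrite ler_wpM2l // divr_ge0 ?exprn_ge0 ?ltW.
Qed.

(** Built up from the right end: the rightmost factor A costs g^(-1/2), each [E] costs delta, and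
    each R^(k) costs g^(1-k). *)
Lemma word_balanced n s x : size s = n.+1 ->
  balanced (word s x) (delta ^+ n * g ^+ n.+1 / g ^+ sumn s * (N x / gs)).
Proof.
have gs0 := sqrt_gap_gt0.
elim: n s => [|n IH] [|k [|k1 s]] // ss.
  have := @balanced_res_pow k x (N x / gs); rewrite /= addn0 expr0 mul1r expr1; apply.
    rewrite mulrC divfK ?gt_eqF // (le_trans (nrm_ip_le ip_norm _ _)) //.
    by rewrite (onb_nrm ip_norm u_onb) // mulr1.
  by rewrite mulrC abs_resolvent_sqrt_le.
have [] := balanced_E (IH (k1 :: s) _); first exact: succn_inj ss.
move=> h1 h2; have := balanced_res_pow k h1 h2.
rewrite (word_cons k) // => h; set B := (X in balanced _ X).
suff -> : B = g / g ^+ k * (delta * (delta ^+ n * g ^+ n.+1 /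
  g ^+ sumn (k1 :: s) * (N x / gs))) by [].
rewrite /B -[sumn (k :: _)]/(k + sumn (k1 :: s))%N exprD !exprS; field.
by rewrite !gt_eqF ?exprn_gt0.
Qed.

Lemma word_le n s x : size s = n.+1 ->
  N (word s x) <= delta ^+ n * g ^+ n / g ^+ sumn s * N x.
Proof.
move=> /(word_balanced x) /balanced_le /le_trans; apply.
rewrite le_eqVlt; apply/orP; left; apply/eqP.
rewrite -mulrA -[N x / gs / gs]mulrA -invfM gsK exprS; field.
by rewrite !gt_eqF ?exprn_gt0.
Qed.

(** The bound on the number of words times the bound on each of them. *)
Definition wbound n m : R := 2 ^+ (n + m) * (delta ^+ n * g ^+ n / g ^+ m).

Lemma word_sum_le n m x : N (W n m x) <= wbound n m * N x.
Proof.
apply: le_trans (nrm_sum _ _ _ _) _.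
apply: le_trans (_ : \sum_(s <- comps n m) (delta ^+ n * g ^+ n / g ^+ m * N x) <= _).
  rewrite big_seq [leRHS]big_seq; apply: ler_sum => s; rewrite mem_comps.
  by move=> /andP[/eqP ss /eqP <-]; exact: word_le.
rewrite big_const_seq count_predT iter_addr_0 -mulr_natl /wbound -[leRHS]mulrA ler_wpM2r //.
  by rewrite !mulr_ge0 ?invr_ge0 ?exprn_ge0 ?nrm_ge0 // ltW.
by rewrite -natrX ler_nat size_comps.
Qed.

End Bounds.
End Words.

(** * Localisation of the perturbed eigenvalues *)

Section EigenvalueLocalisation.
Context (R : realType) (K : numFieldType) (F : scalars R K).
Context (H : completeNormedModType K) (ip : {dot H for conj F}).
Context (ip_norm : norm_from_dot ip).
Context (d : option nat) (u : nat -> H) (u_onb : orthonormal_basis ip d u).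
Context (lam : nat -> R) (j : nat) (jd : in_dim d j).
Context (g : R) (g_gt0 : 0 < g).
Context (gap_below : forall k, in_dim d k -> (k < j)%N -> g <= lam k - lam j).
Context (gap_above : forall k, in_dim d k -> (j < k)%N -> g <= lam j - lam k).
Context (L : R) (lam_bd : forall k, in_dim d k -> `|lam k - lam j| <= L).
Context (E : H -> H) (E_sa : self_adjoint ip E).
Local Notation e := (emb F).
Local Notation N := (nrm F).
Local Notation A0 := (abs_resolvent_sqrt ip d u lam j).
Local Notation gs := (Num.sqrt g).
Context (delta : R) (delta_gt0 : 0 < delta) (delta_lt : 2 * delta < 1).
Context (EAA : forall x, N (A0 (E (A0 x))) <= delta * N x).
Context (EAP : N (A0 (E (u j))) <= delta * gs).
Context (EPP : nrm F (ip (E (u j)) (u j)) <= delta * g).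

Lemma gap_abs k : in_dim d k -> k != j -> g <= `|lam k - lam j|.
Proof.
move=> kd; rewrite neq_ltn => /orP[kj|kj].
  by rewrite (le_trans (gap_below kd kj)) // ler_norm.
by rewrite distrC (le_trans (gap_above kd kj)) // ler_norm.
Qed.

Let E_lin : linear E := adjoint_linear ip_norm E_sa.
Let A0_diag := abs_resolvent_sqrt_diag ip_norm u_onb g_gt0 gap_abs.
Let A0_sa : self_adjoint ip A0 := is_diag_self_adjoint ip_norm u_onb A0_diag.
Let A0_lin : linear A0 := is_diag_linear ip_norm u_onb A0_diag.

(** These are the eigenvalues of A^(-1) = |S - lam_j|^(1/2) + g^(1/2) P_j, which is the operator
    [B]. *)
Let b k := if k == j then gs else Num.sqrt `|lam k - lam j|.
Let B := diag_op ip d u b.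

Let B_diag : is_diag ip d u B b.
Proof.
apply: (diag_op_is_diag ip_norm u_onb (M := Num.max gs (Num.sqrt L))) => k kd.
rewrite /b le_max; case: ifPn => [_|kj]; rewrite ger0_norm ?sqrtr_ge0 ?lexx //.
by apply/orP; right; rewrite ler_wsqrtr // lam_bd.
Qed.

Let b_sqr k : b k * b k = if k == j then g else `|lam k - lam j|.
Proof. by rewrite /b; case: ifP => _; rewrite -expr2 sqr_sqrtr // ltW. Qed.

(** Write x = A z and let p', q be the norms of the parts of z along [u j] and orthogonal to it. The
    block bounds on A E A give at most delta (q + p')^2 <= 2 delta (q^2 + p'^2), and the last sum is
    the form of B^2. *)
Lemma form_perturbation x : `|re F (ip (E x) x)| <= 2 * delta * re F (ip (B (B x)) x).
Proof.
have gs0 : 0 < gs by rewrite sqrtr_gt0.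
set z := B x; pose p := ip z (u j); pose zq := z - p *: u j.
pose c := e gs^-1 * p.
have Aj : A0 (u j) = 0.
  by rewrite (is_diag_basis u_onb A0_diag) // eqxx rmorph0 scale0r.
have xE : x = A0 zq + c *: u j.
  rewrite /zq (linB A0_lin) (linZ A0_lin) Aj scaler0 subr0.
  apply: (onb_ext u_onb) => k kd; rewrite ipDl ipZl A0_diag // (onb_ip u_onb) //.
  rewrite /c /p /z !B_diag // /b; have [->|kj] := eqVneq k j.
    by rewrite ?eqxx rmorph0 mul0r add0r mulr1 mulrA -rmorphM mulVf ?gt_eqF // rmorph1 mul1r.
  rewrite mulr0 addr0 mulrA -rmorphM mulVf ?rmorph1 ?mul1r //.
  by rewrite gt_eqF // sqrtr_gt0 (lt_le_trans g_gt0) // gap_abs.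
have pE : nrm F c * gs = nrm F p.
  rewrite /c nrmM nrm_emb gtr0_norm ?invr_gt0 // mulrC mulrA mulfV ?mul1r //.
  by rewrite gt_eqF.
pose q := N zq; pose p' := nrm F p.
have zN : re F (ip (B z) x) = q ^+ 2 + p' ^+ 2.
  rewrite (is_diag_self_adjoint ip_norm u_onb B_diag) (re_ip_sqr ip_norm).
  have -> : z = zq + p *: u j by rewrite /zq subrK.
  rewrite (nrm_sqrD ip_norm) ipZr /zq ipBl ipZl (onb_ip u_onb) // eqxx mulr1 subrr.
  by rewrite mulr0 re0 mulr0 addr0 nrmZ (onb_nrm ip_norm u_onb) // mulr1.
have key w B' : balanced ip d u lam j g w B' ->
    nrm F (ip (E w) x) <= delta * B' * (q + p').
  move=> /(balanced_E ip_norm u_onb g_gt0 gap_abs E_sa delta_gt0 EAA EAP EPP).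
  move=> [h1 h2]; rewrite [in X in ip _ X]xE ipDr ipZr mulrDr.
  apply: le_trans (nrmD _ _ _) _; apply: lerD.
    rewrite -A0_sa; apply: le_trans (nrm_ip_le ip_norm _ _) _.
    by rewrite ler_wpM2r ?nrm_ge0.
  rewrite nrmM nrm_conj; apply: le_trans (ler_wpM2l (nrm_ge0 _ _) h1) _.
  by rewrite mulrA pE mulrC.
have h1 : balanced ip d u lam j g (A0 zq) q by right; exists zq.
have h2 : balanced ip d u lam j g (c *: u j) p' by left; exists c; rewrite ?pE.
rewrite zN; apply: le_trans (abs_re_le _ _) _.
rewrite [in X in E X]xE (linD E_lin) ipDl.
apply: le_trans (nrmD _ _ _) _.
apply: le_trans (lerD (key _ _ h1) (key _ _ h2)) _.
rewrite -subr_ge0 [leRHS](_ : _ = delta * (q - p') ^+ 2); last by ring.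
by rewrite mulr_ge0 ?sqr_ge0 // ltW.
Qed.

Context (S Sh : H -> H) (S_diag : is_diag ip d u S lam).
Context (ShE : forall x, Sh x = S x + E x).

(** Eigenvalues of S + 2 delta A^(-2) and S - 2 delta A^(-2), between which [Sh] lies in the sense
    of forms. *)
Let coefG k := lam k + 2 * delta * (b k * b k).
Let coefL k := lam k - 2 * delta * (b k * b k).

Lemma form_Sh_le x (c : R) :
  (forall k, in_dim d k -> ip x (u k) != 0 -> coefG k <= c) ->
  re F (ip (Sh x) x) <= c * N x ^+ 2.
Proof.
move=> hc.
have TG := is_diagD S_diag (is_diagZ (2 * delta) (is_diag_comp B_diag B_diag)).
apply: le_trans (is_diag_form_le ip_norm u_onb TG hc).
rewrite ShE !ipDl !reD ipZl re_embM lerD2l.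
exact: le_trans (ler_norm _) (form_perturbation x).
Qed.

Lemma form_Sh_ge x (c : R) :
  (forall k, in_dim d k -> ip x (u k) != 0 -> c <= coefL k) ->
  c * N x ^+ 2 <= re F (ip (Sh x) x).
Proof.
move=> hc.
have TG := is_diagD S_diag
  (is_diagN (is_diagZ (2 * delta) (is_diag_comp B_diag B_diag))).
apply: le_trans (is_diag_form_ge ip_norm u_onb TG hc) _.
rewrite ShE !ipDl !reD ipNl reN ipZl re_embM lerD2l.
by have := form_perturbation x; rewrite ler_norml => /andP[].
Qed.

Context (uh : nat -> H) (uh_onb : orthonormal_basis ip d uh).
Context (lamh : nat -> R) (Sh_diag : is_diag ip d uh Sh lamh).
Context (lamh_mon : forall k l, in_dim d k -> in_dim d l -> (k <= l)%N ->
  lamh l <= lamh k).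

Let coefG_above k : in_dim d k -> (j < k)%N ->
  coefG k <= lam j - (1 - 2 * delta) * g.
Proof.
move=> kd jk; have h := gap_above kd jk.
rewrite /coefG b_sqr (gtn_eqF jk) distrC ger0_norm; last exact: le_trans (ltW g_gt0) h.
have : 0 <= (1 - 2 * delta) * (lam j - lam k - g).
  by apply: mulr_ge0; rewrite subr_ge0 // ltW.
lra.
Qed.

Let coefL_below k : in_dim d k -> (k < j)%N ->
  lam j + (1 - 2 * delta) * g <= coefL k.
Proof.
move=> kd jk; have h := gap_below kd jk.
rewrite /coefL b_sqr (ltn_eqF jk) ger0_norm; last exact: le_trans (ltW g_gt0) h.
have : 0 <= (1 - 2 * delta) * (lam k - lam j - g).
  by apply: mulr_ge0; rewrite subr_ge0 // ltW.
lra.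
Qed.

Let coefGj : coefG j = lam j + 2 * delta * g.
Proof. by rewrite /coefG b_sqr eqxx. Qed.

Let coefLj : coefL j = lam j - 2 * delta * g.
Proof. by rewrite /coefL b_sqr eqxx. Qed.

Let slack : 0 <= (1 - 2 * delta) * g /\ 0 <= 2 * delta * g.
Proof.
have h : 0 <= 1 - 2 * delta by rewrite subr_ge0 ltW.
by split; rewrite !mulr_ge0 ?(ltW g_gt0) ?(ltW delta_gt0).
Qed.

(** Min-max against the two comparison operators. As 2 delta < 1, [coefL] at the indices below [j]
    stays above [lam j] and [coefG] at those beyond [j] stays below it, so index [j] gives the
    extreme value. *)
Lemma eigenvalue_near : `|lamh j - lam j| <= 2 * delta * g.
Proof.
have [s1 s2] := slack.
rewrite ler_norml; apply/andP; split.
  suff : lam j - 2 * delta * g <= lamh j by lra.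
  apply: (minmax_ge ip_norm u_onb uh_onb Sh_diag lamh_mon jd) => x xl.
  apply: form_Sh_ge => k kd xk; case: (ltngtP k j) => kj.
  - by have := coefL_below kd kj; lra.
  - by rewrite xl // eqxx in xk.
  - by rewrite kj coefLj.
suff : lamh j <= lam j + 2 * delta * g by lra.
apply: (minmax_le ip_norm (u := u) uh_onb Sh_diag lamh_mon jd) => x xl.
apply: form_Sh_le => k kd xk; case: (ltngtP k j) => kj.
- by rewrite xl // eqxx in xk.
- by have := coefG_above kd kj; lra.
- by rewrite kj coefGj.
Qed.

(** The test vectors for [k < j] involve only indices up to [k], those for [k > j] only indices from
    [k] on; index [j] never enters and the full gap, reduced by the factor 1 - 2 delta, survives. *)
Lemma eigenvalue_far k : in_dim d k -> k != j ->
  (1 - 2 * delta) * g <= `|lamh k - lam j|.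
Proof.
move=> kd; rewrite neq_ltn => /orP[kj|kj].
  suff h : lam j + (1 - 2 * delta) * g <= lamh k.
    by apply: le_trans (ler_norm _); lra.
  apply: (minmax_ge ip_norm u_onb uh_onb Sh_diag lamh_mon kd) => x xl.
  apply: form_Sh_ge => l ld; have [kl|lk] := ltnP k l; first by rewrite xl ?eqxx.
  by move=> _; apply: coefL_below => //; exact: leq_ltn_trans lk kj.
suff h : lamh k <= lam j - (1 - 2 * delta) * g.
  by rewrite distrC; apply: le_trans (ler_norm _); lra.
apply: (minmax_le ip_norm (u := u) uh_onb Sh_diag lamh_mon kd) => x xl.
apply: form_Sh_le => l ld; have [lk|kl] := ltnP l k; first by rewrite xl ?eqxx.
by move=> _; apply: coefG_above => //; exact: leq_trans kj kl.
Qed.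

End EigenvalueLocalisation.

(** * Strong convergence of the projection series and identification of its limit *)

Lemma geometric_tail_le (R : realType) (q : R) m n : 0 <= q < 1 ->
  \sum_(m <= p < n) q ^+ p <= q ^+ m / (1 - q).
Proof.
move=> /andP[q0 q1].
have q1' : 0 < 1 - q by rewrite subr_gt0.
have [nm|mn] := leqP n m.
  by rewrite big_geq // divr_ge0 ?exprn_ge0 // ltW.
rewrite ler_pdivlMr // -(subnKC (ltnW mn)); move: (n - m)%N => {mn}k.
suff -> : (\sum_(m <= p < m + k) q ^+ p) * (1 - q) = q ^+ m - q ^+ (m + k).
  by rewrite gerBl exprn_ge0.
elim: k => [|k IH]; first by rewrite addn0 big_geq // mul0r subrr.
by rewrite addnS big_nat_recr ?leq_addr //= mulrDl IH exprS; ring.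
Qed.

Section Expansion.
Context (R : realType) (K : numFieldType) (F : scalars R K).
Context (H : completeNormedModType K) (ip : {dot H for conj F}).
Context (ip_norm : norm_from_dot ip).
Context (d : option nat) (u : nat -> H) (u_onb : orthonormal_basis ip d u).
Context (lam : nat -> R) (j : nat) (jd : in_dim d j).
Context (g : R) (g_gt0 : 0 < g).
Context (lam_gap : forall k, in_dim d k -> k != j -> g <= `|lam k - lam j|).
Context (E : H -> H) (E_sa : self_adjoint ip E).
Context (D : H -> H) (D_diag : is_diag ip d u D (fun k => lam k - lam j)).
Local Notation e := (emb F).
Local Notation N := (nrm F).
Local Notation A0 := (abs_resolvent_sqrt ip d u lam j).
Local Notation gs := (Num.sqrt g).
Context (delta : R) (delta_gt0 : 0 < delta) (delta_lt : 4 * delta < 1).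
Context (EAA : forall x, N (A0 (E (A0 x))) <= delta * N x).
Context (EAP : N (A0 (E (u j))) <= delta * gs).
Context (EPP : nrm F (ip (E (u j)) (u j)) <= delta * g).
Context (CE : R) (CE_ge0 : 0 <= CE) (E_bd : forall x, N (E x) <= CE * N x).
Context (uh : nat -> H) (uh_onb : orthonormal_basis ip d uh).
Context (lamh : nat -> R).
Context (Dh_diag : is_diag ip d uh (fun x => D x + E x) (fun k => lamh k - lam j)).
Context (near : `|lamh j - lam j| <= 2 * delta * g).
Context (far : forall k, in_dim d k -> k != j ->
  (1 - 2 * delta) * g <= `|lamh k - lam j|).

Local Notation W := (word_sum ip d u lam j E).
Local Notation q := (4 * delta).
Local Notation wb := (wbound g delta).

Let q_bd : 0 <= q < 1.
Proof. by rewrite delta_lt mulr_ge0 // ltW. Qed.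

Let q1 : 0 < 1 - q.
Proof. by rewrite subr_gt0. Qed.

(** Along each diagonal n - m = c the bound is geometric of ratio 4 delta; the offset only enters
    the prefactor. *)
Lemma wbound_above p c : wb (p + c) p = q ^+ p * (2 * delta * g) ^+ c.
Proof.
have p22 : (4 : R) ^+ p = 2 ^+ p * 2 ^+ p by rewrite -exprMn; congr (_ ^+ _); ring.
rewrite /wbound !exprMn !exprD p22; field.
by rewrite expf_neq0 // gt_eqF.
Qed.

Lemma wbound_below n c : wb n (n + c) = q ^+ n * (2 / g) ^+ c.
Proof.
have p22 : (4 : R) ^+ n = 2 ^+ n * 2 ^+ n by rewrite -exprMn; congr (_ ^+ _); ring.
rewrite /wbound !exprMn exprVn !exprD p22; field.
by rewrite !expf_neq0 // gt_eqF.
Qed.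

Section MatrixElement.
Context (x : H) (l : nat) (ld : in_dim d l).
Local Notation mu := (lamh l - lam j).
Let a n m := ip (W n m x) (uh l).
Let ee n m := ip (E (W n m x)) (uh l).

Let a_le n m : nrm F (a n m) <= wb n m * N x.
Proof.
apply: le_trans (nrm_ip_le ip_norm _ _) _.
rewrite (onb_nrm ip_norm uh_onb) // mulr1.
exact: (word_sum_le ip_norm u_onb jd g_gt0 lam_gap E_sa delta_gt0 EAA EAP EPP).
Qed.

Let ee_le n m : nrm F (ee n m) <= CE * N x * wb n m.
Proof.
apply: le_trans (nrm_ip_le ip_norm _ _) _.
rewrite (onb_nrm ip_norm uh_onb) // mulr1 (le_trans (E_bd _)) // -mulrA ler_wpM2l //.
rewrite mulrC.
exact: (word_sum_le ip_norm u_onb jd g_gt0 lam_gap E_sa delta_gt0 EAA EAP EPP).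
Qed.

Let mu_a n m : e mu * a n m = ip (D (W n m x)) (uh l) + ee n m.
Proof. by rewrite /a -Dh_diag // ipDl. Qed.

(** Truncated matrix elements of Z_c, and below of Z_(-c), between [x] and [uh l]. The sign exponent
    is one more than the number of factors [E]. *)
Let zsum c n : K := \sum_(0 <= p < n) (-1) ^+ (p + c).+1 * a (p + c) p.
Let ysum c n : K := \sum_(0 <= p < n) (-1) ^+ p.+1 * a p (p + c).

(* The terms [E W] cancel pairwise along each diagonal [n - m = c], except the
   last one. *)
Let zsum_rec c n : e mu * zsum c n.+1 =
  zsum c.+1 n + (-1) ^+ (n + c).+1 * ee (n + c) n.
Proof.
elim: n => [|n IH].
  rewrite /zsum big_nat1 big_geq // add0r mulrCA mu_a add0n.
  by rewrite (D_word_sum_n0 ip_norm u_onb jd g_gt0 lam_gap E D_diag) ip0l add0r.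
rewrite {1}/zsum big_nat_recr //= -/(zsum c n.+1) mulrDr IH mulrCA mu_a addSn.
rewrite (D_word_sum ip_norm u_onb jd g_gt0 lam_gap E_sa D_diag) ipDl.
rewrite -/(a _ _) -/(ee _ _) [in RHS]/zsum big_nat_recr //= -/(zsum c.+1 n) addnS !exprS.
by ring.
Qed.

(** The same cancellation below the diagonal. For [c = 0] the first term, D W 0 1 = W 0 0 + 1,
    produces the subtracted identity. *)
Let ysum_rec c n : e mu * ysum c.+1 n.+1 =
  ysum c n.+1 - (if c == 0%N then ip x (uh l) else 0) + (-1) ^+ n.+1 * ee n (n + c).+1.
Proof.
elim: n => [|n IH].
  rewrite /ysum !big_nat1 mulrCA mu_a !add0n.
  rewrite (D_word_sum_0S ip_norm u_onb jd g_gt0 lam_gap E D_diag) ipDl.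
  by rewrite -/(a _ _); case: ifP => _; rewrite ?ip0l; ring.
rewrite {1}/ysum big_nat_recr //= -/(ysum c.+1 n.+1) mulrDr IH mulrCA mu_a !addnS !addSn.
rewrite (D_word_sum ip_norm u_onb jd g_gt0 lam_gap E_sa D_diag) ipDl.
rewrite -/(a _ _) -/(ee _ _) [in RHS]/ysum [in RHS]big_nat_recr //= -/(ysum c n.+1) !addSn !exprS.
by ring.
Qed.

Let zsum_le c n : nrm F (zsum c n) <= (1 - q)^-1 * N x * (2 * delta * g) ^+ c.
Proof.
have dg0 : 0 <= (2 * delta * g) ^+ c.
  by rewrite exprn_ge0 // !mulr_ge0 // ltW.
apply: le_trans (nrm_sum _ _ _ _) _.
apply: le_trans (_ : (\sum_(0 <= p < n) q ^+ p) * (2 * delta * g) ^+ c * N x <= _).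
  rewrite !mulr_suml; apply: ler_sum => p _; rewrite nrmM nrm_sign mul1r.
  by rewrite -wbound_above.
rewrite -mulrA [leRHS]mulrAC -[leRHS]mulrA ler_wpM2r ?mulr_ge0 ?nrm_ge0 //.
by have := geometric_tail_le 0 n q_bd; rewrite expr0 mul1r.
Qed.

Let ysum_le c n : nrm F (ysum c n) <= (1 - q)^-1 * N x * (2 / g) ^+ c.
Proof.
have dg0 : 0 <= (2 / g) ^+ c by rewrite exprn_ge0 // divr_ge0 // ltW.
apply: le_trans (nrm_sum _ _ _ _) _.
apply: le_trans (_ : (\sum_(0 <= p < n) q ^+ p) * (2 / g) ^+ c * N x <= _).
  rewrite !mulr_suml; apply: ler_sum => p _; rewrite nrmM nrm_sign mul1r.
  by rewrite -wbound_below.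
rewrite -mulrA [leRHS]mulrAC -[leRHS]mulrA ler_wpM2r ?mulr_ge0 ?nrm_ge0 //.
by have := geometric_tail_le 0 n q_bd; rewrite expr0 mul1r.
Qed.

(** Each use of [zsum_rec] shortens the sum by one term and leaves a remainder of order q^n, whose
    constant may depend on [c]. *)
Let zsum_iter c : exists C, forall n,
  `|mu| ^+ c * nrm F (zsum 0 (n + c)) <= nrm F (zsum c n) + C * q ^+ n.
Proof.
elim: c => [|c [C IH]].
  by exists 0 => n; rewrite expr0 mul1r addn0 mul0r addr0.
exists (`|mu| * C * q + CE * N x * (2 * delta * g) ^+ c) => n.
rewrite exprS -mulrA addnS -addSn.
apply: le_trans (ler_wpM2l (normr_ge0 _) (IH n.+1)) _.
have h : `|mu| * nrm F (zsum c n.+1) <=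
    nrm F (zsum c.+1 n) + CE * N x * (2 * delta * g) ^+ c * q ^+ n.
  rewrite -(nrm_emb F) -nrmM zsum_rec; apply: le_trans (nrmD _ _ _) _.
  rewrite lerD2l nrmM nrm_sign mul1r (le_trans (ee_le _ _)) // wbound_above.
  by rewrite -!mulrA [(2 * _) ^+ _ * _]mulrC.
rewrite mulrDr exprS; apply: le_trans (lerD h (lexx _)) _.
by rewrite le_eqVlt; apply/orP; left; apply/eqP; ring.
Qed.

Let nrm_le_add (z r : K) : nrm F z <= nrm F (z + r) + nrm F r.
Proof. by rewrite -{1}(addrK r z) nrmB. Qed.

(** The first step subtracts the identity, the later ones only pass to lower diagonals; the
    truncation keeps its length here. *)
Let ysum_iter c : exists C, forall n, nrm F (ysum 0 n.+1 - ip x (uh l)) <=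
  `|mu| ^+ c.+1 * nrm F (ysum c.+1 n.+1) + C * q ^+ n.
Proof.
elim: c => [|c [C IH]].
  exists (CE * N x * (2 / g)) => n; rewrite expr1 -(nrm_emb F) -nrmM ysum_rec eqxx.
  rewrite addn0; apply: le_trans (nrm_le_add _ ((-1) ^+ n.+1 * ee n n.+1)) _.
  rewrite lerD2l nrmM nrm_sign mul1r.
  apply: le_trans (ee_le _ _) _; rewrite -addn1 wbound_below expr1.
  by rewrite le_eqVlt; apply/orP; left; apply/eqP; ring.
exists (C + `|mu| ^+ c.+1 * (CE * N x * (2 / g) ^+ c.+2)) => n.
apply: le_trans (IH n) _.
have h : nrm F (ysum c.+1 n.+1) <=
    `|mu| * nrm F (ysum c.+2 n.+1) + CE * N x * (2 / g) ^+ c.+2 * q ^+ n.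
  rewrite -(nrm_emb F) -nrmM ysum_rec subr0.
  apply: le_trans (nrm_le_add _ ((-1) ^+ n.+1 * ee n (n + c.+1).+1)) _.
  rewrite lerD2l nrmM nrm_sign mul1r.
  apply: le_trans (ee_le _ _) _; rewrite -addnS wbound_below.
  by rewrite le_eqVlt; apply/orP; left; apply/eqP; ring.
have := ler_wpM2l (exprn_ge0 c.+1 (normr_ge0 mu)) h.
move=> {}h; apply: le_trans (lerD h (lexx _)) _.
by rewrite le_eqVlt; apply/orP; left; apply/eqP; rewrite ![_ ^+ c.+2]exprS; ring.
Qed.

Lemma proj_series_coord_cvg :
  nrm F (zsum 0 n - (l == j)%:R * ip x (uh l)) @[n --> \oo] --> (0 : R).
Proof.
have [lj|lj] := eqVneq l j.
  have zy n : zsum 0 n = ysum 0 n by apply: eq_bigr => p _; rewrite addn0.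
  under eq_fun do rewrite mul1r zy.
  (* By [near], 2 |mu| / g <= 4 delta = q. The constant carries one factor [q] because [ysum_iter]
     yields the power c + 1. *)
  apply: (@cvg0_of_two_rates _ _ ((1 - q)^-1 * N x * q) q q) => // c.
  have [C hC] := ysum_iter c; exists C, 1%N => -[//|n] _.
  rewrite ger0_norm ?nrm_ge0 // subSS subn0; apply: le_trans (hC n) _.
  rewrite lerD2r -[leRHS]mulrA -exprS.
  apply: le_trans (ler_wpM2l (exprn_ge0 _ (normr_ge0 _)) (ysum_le _ _)) _.
  rewrite mulrCA ler_wpM2l ?mulr_ge0 ?invr_ge0 ?nrm_ge0 ?(ltW q1) //.
  rewrite -exprMn lerXn2r ?nnegrE ?mulr_ge0 ?invr_ge0 ?(ltW g_gt0) ?(ltW delta_gt0) //.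
  rewrite mulrA ler_pdivrMr // lj mulrC.
  have : 2 * `|lamh j - lam j| <= 2 * (2 * delta * g) by rewrite ler_wpM2l.
  by move/le_trans; apply; rewrite le_eqVlt; apply/orP; left; apply/eqP; ring.
under eq_fun do rewrite mul0r subr0.
have mu_ge := far ld lj.
(* Hence the growth rate 2 delta g of Z_c lies strictly below |mu| >= (1 - 2 delta) g. *)
have d2 : 2 * delta < 1 - 2 * delta by move: delta_lt; lra.
have mu0 : 2 * delta * g < `|mu|.
  by apply: lt_le_trans mu_ge; rewrite ltr_pM2r.
have dg0 : 0 <= 2 * delta * g by rewrite !mulr_ge0 ?(ltW g_gt0) ?(ltW delta_gt0).
have mu1 : 0 < `|mu| by apply: le_lt_trans mu0.
apply: (@cvg0_of_two_rates _ _ ((1 - q)^-1 * N x) (2 * delta * g / `|mu|) q) => //.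
  by rewrite divr_ge0 //= ltr_pdivrMr // mul1r.
move=> c; have [C hC] := zsum_iter c.
exists (C / `|mu| ^+ c), c => n cn; have := hC (n - c)%N; rewrite subnK // => h.
rewrite ger0_norm ?nrm_ge0 // -(ler_pM2l (exprn_gt0 c mu1)); apply: le_trans h _.
rewrite mulrDr; apply: lerD; last first.
  by rewrite mulrA [_ / _]mulrC mulVKf // expf_neq0 // gt_eqF.
apply: le_trans (zsum_le _ _) _; rewrite expr_div_n mulrCA ler_wpM2l //.
  by rewrite mulr_ge0 ?invr_ge0 ?nrm_ge0 // ltW.
by rewrite mulrCA divff ?mulr1 // expf_neq0 // gt_eqF.
Qed.

End MatrixElement.

Local Notation P_ := (proj_term ip d u lam j E).

Lemma proj_term_le n x : N (P_ n x) <= q ^+ n * N x.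
Proof.
rewrite proj_termE nrmZ nrm_sign mul1r.
have := word_sum_le ip_norm u_onb jd g_gt0 lam_gap E_sa delta_gt0 EAA EAP EPP n n x.
by have := wbound_above n 0; rewrite addn0 expr0 mulr1 => ->.
Qed.

(** The bounds q^n |x| make the series Cauchy; its limit is then recognised from its coordinates in
    the basis [uh]. *)
Lemma proj_series_cvg x :
  (fun n => \sum_(0 <= p < n) P_ p x) @ \oo --> eig_proj ip uh j x.
Proof.
have cv : cvg ((fun n => \sum_(0 <= p < n) P_ p x) @ \oo).
  apply: (cauchy_nrm_cvg (F := F)) => eps eps0.
  have : geometric ((1 - q)^-1 * N x) q @ \oo --> (0 : R).
    by apply: cvg_geometric; rewrite ger0_norm; case/andP: q_bd.
  move/cvgr0Pnorm_lt => /(_ _ eps0) [M _ hM]; exists M => m n Mm mn.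
  rewrite (big_cat_nat (n := m)) //= addrAC subrr add0r.
  have /= := hM m Mm; apply: le_lt_trans; apply: le_trans (ler_norm _).
  apply: le_trans (nrm_sum _ _ _ _) _.
  apply: le_trans (ler_sum _ (fun p _ => proj_term_le p x)) _.
  rewrite -mulr_suml mulrAC ler_wpM2r ?nrm_ge0 // [leRHS]mulrC.
  exact: geometric_tail_le.
suff <- : lim ((fun n => \sum_(0 <= p < n) P_ p x) @ \oo) = eig_proj ip uh j x by [].
apply: (onb_ext uh_onb) => l ld.
move/(cvg_ipl ip_norm (y := uh l)): cv => h1.
apply: (cvg_unique _ h1) => //.
apply/(cvg_nrm F); have := proj_series_coord_cvg x ld.
have -> : ip (eig_proj ip uh j x) (uh l) = (l == j)%:R * ip x (uh l).
  rewrite (is_diag_proj uh_onb jd) //.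
  by case: (l == j); rewrite ?rmorph1 ?rmorph0.
suff E' n : ip (\sum_(0 <= p < n) P_ p x) (uh l) =
    \sum_(0 <= p < n) (-1) ^+ (p + 0).+1 * ip (W (p + 0) p x) (uh l).
  by under eq_fun do rewrite -E'; exact.
rewrite ip_suml; apply: eq_bigr => p _; by rewrite proj_termE ipZl addn0.
Qed.

End Expansion.

(** * Hilbert-Schmidt convergence and the eigenvalue series *)

Lemma cvg_sum (K : numFieldType) (V : normedModType K) (I : Type) (s : seq I)
    (P : pred I) (f : I -> nat -> V) (l : I -> V) :
  (forall i, P i -> f i n @[n --> \oo] --> l i) ->
  \sum_(i <- s | P i) f i n @[n --> \oo] --> \sum_(i <- s | P i) l i.
Proof.
move=> fl; elim: s => [|i s IH].
  by rewrite big_nil; under eq_fun do rewrite big_nil; exact: cvg_cst.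
rewrite big_cons; under eq_fun do rewrite big_cons.
by case: ifP => Pi //; apply: cvgD => //; exact: fl.
Qed.

Lemma nrm_lim_le (R : realType) (K : numFieldType) (F : scalars R K)
    (V : normedModType K) (f : nat -> V) (l : V) (B : R) :
  (\forall n \near \oo, nrm F (f n) <= B) -> f @ \oo --> l -> nrm F l <= B.
Proof.
move=> fB /(cvg_of_nrm (F := F)) fl.
exact: (ler_cvg_to fl (cvg_cst B) fB).
Qed.

Section TraceAndHS.
Context (R : realType) (K : numFieldType) (F : scalars R K).
Context (H : completeNormedModType K) (ip : {dot H for conj F}).
Context (ip_norm : norm_from_dot ip).
Context (d : option nat) (u : nat -> H) (u_onb : orthonormal_basis ip d u).
Context (lam : nat -> R) (j : nat) (jd : in_dim d j).
Context (g : R) (g_gt0 : 0 < g).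
Context (lam_gap : forall k, in_dim d k -> k != j -> g <= `|lam k - lam j|).
Context (L : R) (lam_bd : forall k, in_dim d k -> `|lam k - lam j| <= L).
Context (E : H -> H) (E_sa : self_adjoint ip E).
Context (D : H -> H) (D_diag : is_diag ip d u D (fun k => lam k - lam j)).
Local Notation e := (emb F).
Local Notation N := (nrm F).
Local Notation A0 := (abs_resolvent_sqrt ip d u lam j).
Local Notation gs := (Num.sqrt g).
Context (delta : R) (delta_gt0 : 0 < delta) (delta_lt : 4 * delta < 1).
Context (EAA : forall x, N (A0 (E (A0 x))) <= delta * N x).
Context (EAP : N (A0 (E (u j))) <= delta * gs).
Context (EPP : nrm F (ip (E (u j)) (u j)) <= delta * g).
Context (CE : R) (CE_ge0 : 0 <= CE) (E_bd : forall x, N (E x) <= CE * N x).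

Local Notation W := (word_sum ip d u lam j E).
Local Notation word := (res_word ip d u lam j E).
Local Notation q := (4 * delta).
Local Notation wb := (wbound g delta).
Local Notation P_ := (proj_term ip d u lam j E).
Local Notation lam_ := (eigenvalue_term ip d u lam j E).
Local Notation ptr := (ptrace ip d u).

Let q_bd : 0 <= q < 1.
Proof. by rewrite delta_lt mulr_ge0 // ltW. Qed.

Let q0 : 0 < q.
Proof. by rewrite mulr_gt0. Qed.

Let q1 : 0 < 1 - q.
Proof. by rewrite subr_gt0. Qed.

Let E_lin : linear E := adjoint_linear ip_norm E_sa.
Let D_lin : linear D := is_diag_linear ip_norm u_onb D_diag.
Let W_lin n m : linear (W n m) :=
  word_sum_linear ip_norm u_onb jd g_gt0 lam_gap E_sa n m.

Let W_le n m x : N (W n m x) <= wb n m * N x :=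
  word_sum_le ip_norm u_onb jd g_gt0 lam_gap E_sa delta_gt0 EAA EAP EPP n m x.

Let wbase n m : R := delta ^+ n * g ^+ n / g ^+ m.

Let wbase_gt0 n m : 0 < wbase n m.
Proof. by rewrite /wbase ?mulr_gt0 ?invr_gt0 ?exprn_gt0. Qed.

Let size_wbase n m : (size (comps n m))%:R * wbase n m <= wb n m.
Proof.
by rewrite ler_wpM2r ?(ltW (wbase_gt0 _ _)) // -natrX ler_nat size_comps.
Qed.

Let word_tensor n m s : (m <= n)%N -> s \in comps n m ->
  exists v w, (forall x, word s x = tensor ip v w x) /\ N v * N w <= wbase n m.
Proof.
move=> mn; rewrite mem_comps => /andP[/eqP ss /eqP sm].
have s0 : 0%N \in s by apply: has0_of_sumn_lt_size; rewrite ss sm ltnS.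
have [v [w vw]] := word_rank_one ip_norm u_onb jd g_gt0 lam_gap E_sa s0.
exists v, w; split => //; apply: (tensor_nrm_le ip_norm); first exact: ltW.
move=> x; rewrite -vw -sm.
exact: (word_le ip_norm u_onb jd g_gt0 lam_gap E_sa delta_gt0 EAA EAP EPP).
Qed.

Lemma word_sum_hs_le n m : (m <= n)%N -> hs_le F d u (W n m) (wb n m).
Proof.
move=> mn; apply: (@hs_leS _ _ _ _ _ _ _ (\sum_(s <- comps n m) wbase n m)).
  rewrite sumr_ge0 => [|s _]; last exact: ltW.
  by rewrite big_const_seq count_predT iter_addr_0 -mulr_natl size_wbase.
apply: hs_le_sum => // s /(word_tensor mn) [v [w [vw vwN]]].
apply: (hs_le_eq (fun x => esym (vw x))).
apply: (@hs_leS _ _ _ _ _ _ _ (N v * N w)); last exact: (tensor_hs_le ip_norm u_onb).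
by rewrite vwN mulr_ge0 ?nrm_ge0.
Qed.

Lemma proj_term_hs_le n : hs_le F d u (P_ n) (q ^+ n).
Proof.
apply: (hs_le_eq (fun x => esym (proj_termE ip d u lam j E n x))).
apply: hs_leZ; first exact: nrm_sign.
have := word_sum_hs_le (leqnn n).
by have := wbound_above g_gt0 delta n 0; rewrite addn0 expr0 mulr1 => ->.
Qed.

Lemma proj_term_linear n : linear (P_ n).
Proof.
move=> a x y; rewrite !proj_termE W_lin scalerDr !scalerA; congr (_ *: _ + _).
by rewrite mulrC.
Qed.

Lemma proj_term_hilbert_schmidt n : hilbert_schmidt F d u (P_ n).
Proof.
split; first exact: proj_term_linear.
  exact: (lin_continuous (@proj_term_linear n)
    (proj_term_le ip_norm u_onb jd g_gt0 lam_gap E_sa delta_gt0 EAA EAP EPP n)).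
apply: le_lt_trans (ltry (q ^+ n)); apply: hs_le_hsnorm (proj_term_hs_le n).
by rewrite exprn_ge0 // ltW.
Qed.

Lemma proj_term_hs_summable : (\sum_(0 <= n <oo) hsnorm F d u (P_ n) < +oo)%E.
Proof.
apply: le_lt_trans (ltry ((1 - q)^-1)).
apply: lime_le; first by apply: is_cvg_nneseries => n _ _; exact: sqrte_ge0.
apply: nearW => n.
apply: le_trans (_ : (\sum_(0 <= p < n) (q ^+ p)%:E <= _)%E).
  apply: lee_sum => p _; apply: hs_le_hsnorm (proj_term_hs_le p).
  by rewrite exprn_ge0 // ltW.
rewrite sumEFin lee_fin.
by have := geometric_tail_le 0 n q_bd; rewrite expr0 mul1r.
Qed.

Lemma ptrace_sum (I : Type) (s : seq I) (T : I -> H -> H) n :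
  ptr (fun x => \sum_(i <- s) T i x) n = \sum_(i <- s) ptr (T i) n.
Proof. by rewrite exchange_big; apply: eq_bigr => k _; rewrite ip_suml. Qed.

Lemma ptraceZ a (T : H -> H) n : ptr (fun x => a *: T x) n = a * ptr T n.
Proof. by rewrite mulr_sumr; apply: eq_bigr => k _; rewrite ipZl. Qed.

Lemma ptraceD (T T' : H -> H) n : ptr (fun x => T x + T' x) n = ptr T n + ptr T' n.
Proof. by rewrite -big_split; apply: eq_bigr => k _; rewrite ipDl. Qed.

Lemma ptrace_word_sum_le n m k : (m <= n)%N -> nrm F (ptr (W n m) k) <= wb n m.
Proof.
move=> mn; rewrite ptrace_sum; apply: le_trans (nrm_sum _ _ _ _) _.
apply: le_trans (size_wbase n m).
rewrite mulr_natl -iter_addr_0 -(count_predT (comps n m)) -big_const_seq.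
rewrite big_seq [leRHS]big_seq; apply: ler_sum => s /(word_tensor mn) [v [w [vw vwN]]].
rewrite [ptr _ _](_ : _ = ptr (tensor ip v w) k).
  exact: le_trans (tensor_ptrace_le ip_norm u_onb v w k) vwN.
by apply: eq_bigr => l _; rewrite vw.
Qed.

Lemma ptrace_word_sum_cvg n m (T : H -> H) : (m <= n)%N -> self_adjoint ip T ->
  exists t : K^o, (ptr (W n m \o T) k : K^o) @[k --> \oo] --> t.
Proof.
(* Generalised to any list of words taken from [comps n m], for induction; a word v (x) w composed
   with [T] has trace <v, T w>. *)
move=> mn T_sa; have : {subset comps n m <= comps n m} by [].
rewrite /comp /word_sum; move: {1 3}(comps n m) => l; elim: l => [|s l IH] ls.
  exists 0; rewrite [X in X @ _](_ : _ = fun=> 0); first exact: cvg_cst.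
  by apply: funext => k; rewrite ptrace_sum big_nil.
have [|t ht] := IH; first by move=> s' s'l; apply: ls; rewrite inE s'l orbT.
have [v [w [vw _]]] := word_tensor mn (ls s (mem_head _ _)).
exists (ip v (T w) + t).
rewrite [X in X @ _](_ : _ = fun k => ptr (tensor ip v (T w)) k +
    ptr (fun x => \sum_(s <- l) word s (T x)) k).
  apply: cvgD => //; exact: (tensor_ptrace_cvg ip_norm u_onb).
apply: funext => k; rewrite -ptraceD; apply: eq_bigr => i _.
by rewrite big_cons vw /tensor T_sa.
Qed.

(** The coefficient of [D] at [j] already vanishes. *)
Let ginvE x : resolvent_ginv ip d u lam j x = D x.
Proof.
have L0 : 0 <= L by apply: le_trans (lam_bd jd); exact: normr_ge0.
apply: (onb_ext u_onb) => k kd.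
rewrite (diag_op_is_diag ip_norm u_onb (M := L)) ?D_diag //.
  by have [->|] := eqVneq k j; rewrite ?subrr.
by move=> l ld; case: ifP => _; rewrite ?normr0 // lam_bd.
Qed.

(** By [word_sum_D], tr(P_(n+1) R_j^(-1)) splits into the trace of [W n.+1 n] and that of W n n E,
    up to sign; the latter cancels tr(P_n E). *)
Lemma eigenvalue_term_cvg n :
  ((-1) ^+ n * ptr (W n.+1 n) k : K^o) @[k --> \oo] --> (lam_ n.+1 : K^o).
Proof.
have [t1 h1] := ptrace_word_sum_cvg (leqnn n) E_sa.
have [t2 h2] := @ptrace_word_sum_cvg n.+1 n id (leqnSn n) (fun x y => erefl).
have e1 : trace ip d u (P_ n \o E) = (-1) ^+ n.+1 * t1.
  apply: cvg_lim => //.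
  rewrite [X in X @ _](_ : _ = fun k => (-1) ^+ n.+1 * ptr (W n n \o E) k).
    by apply: (@cvgM K^o) => //; exact: cvg_cst.
  apply: funext => k; rewrite -ptraceZ; apply: eq_bigr => l _.
  by rewrite /= proj_termE.
have e2 : trace ip d u (P_ n.+1 \o resolvent_ginv ip d u lam j) =
    (-1) ^+ n.+2 * (t2 + t1).
  apply: cvg_lim => //.
  rewrite [X in X @ _](_ : _ = fun k => (-1) ^+ n.+2 *
      (ptr (W n.+1 n \o id) k + ptr (W n n \o E) k)).
    by apply: (@cvgM K^o); [exact: cvg_cst|apply: (@cvgD _ K^o)].
  apply: funext => k; rewrite -ptraceD -ptraceZ; apply: eq_bigr => l _.
  rewrite /= proj_termE ginvE.
  by rewrite (word_sum_D ip_norm u_onb jd g_gt0 lam_gap E_sa D_diag).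
have -> : lam_ n.+1 = (-1) ^+ n * t2.
  by rewrite /eigenvalue_term e1 e2 !exprS; ring.
by apply: (@cvgM K^o) => //; exact: cvg_cst.
Qed.

(** Self-adjointness of the word sums makes every partial trace invariant under conjugation, and
    this passes to the limit. *)
Lemma eigenvalue_term_real n : lam_ n \is Num.real.
Proof.
have er (r : R) : e r \is Num.real.
  by rewrite realE emb_ge0 -oppr_ge0 -rmorphN emb_ge0 oppr_ge0 -realE num_real.
case: n => [|n]; first exact: er.
suff -> : lam_ n.+1 = e (re F (lam_ n.+1)) by exact: er.
have h := @eigenvalue_term_cvg n.
apply: (cvg_unique _ h) => //.
have := cvg_emb (F := F) (cvg_re (F := F) h).
suff E' k : e (re F ((-1) ^+ n * ptr (W n.+1 n) k)) = (-1) ^+ n * ptr (W n.+1 n) k.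
  by under eq_fun do rewrite E'; exact.
suff c : conj F ((-1) ^+ n * ptr (W n.+1 n) k) = (-1) ^+ n * ptr (W n.+1 n) k.
  by rewrite emb_re c; field.
rewrite rmorphM rmorphXn rmorphN rmorph1 rmorph_sum; congr (_ * _).
apply: eq_bigr => l _; rewrite /= -ipC.
by rewrite (word_sum_self_adjoint ip_norm u_onb jd g_gt0 lam_gap E_sa).
Qed.

Let wbS n : wb n.+1 n = q ^+ n * (2 * delta * g).
Proof. by have := wbound_above g_gt0 delta n 1; rewrite addn1 expr1. Qed.

(** The summand |lam_j| covers n = 0; for the others the trace bound is 2 delta g q^n = (g / 2)
    q^(n+1). *)
Lemma eigenvalue_term_le n : nrm F (lam_ n) <= (`|lam j| + g / 2) * q ^+ n.
Proof.
case: n => [|n]; first by rewrite expr0 mulr1 /= nrm_emb lerDl divr_ge0 // ltW.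
apply: le_trans (_ : g / 2 * q ^+ n.+1 <= _); last first.
  by rewrite ler_wpM2r ?lerDr // exprn_ge0 // ltW.
apply: (nrm_lim_le (V := K^o) _ (@eigenvalue_term_cvg n)); apply: nearW => k.
rewrite nrmM nrm_sign mul1r (le_trans (ptrace_word_sum_le _ (leqnSn n))) // wbS exprS.
by rewrite le_eqVlt; apply/orP; left; apply/eqP; field.
Qed.

Lemma eigenvalue_term_summable : cvg (series (fun n => `|lam_ n|) @ \oo).
Proof.
have h : cvg (series (fun n => nrm F (lam_ n)) @ \oo).
  apply: (@series_le_cvg _ _ (geometric (`|lam j| + g / 2) q)).
  - by move=> n; exact: nrm_ge0.
  - by move=> n; rewrite /= mulr_ge0 ?addr_ge0 ?exprn_ge0 ?divr_ge0 ?(ltW g_gt0) ?(ltW q0).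
  - exact: eigenvalue_term_le.
  - by apply: is_cvg_geometric_series; rewrite ger0_norm; case/andP: q_bd.
have h' := cvg_emb (F := F) h.
apply/cvg_ex; exists (e (lim (series (fun n => nrm F (lam_ n)) @ \oo))).
suff E' n : e (series (fun n => nrm F (lam_ n)) n) = series (fun n => `|lam_ n|) n.
  by move: h'; under eq_fun do rewrite E'; exact.
by rewrite rmorph_sum; apply: eq_bigr => k _; rewrite emb_nrm.
Qed.

Context (uh : nat -> H) (uh_onb : orthonormal_basis ip d uh).
Context (lamh : nat -> R).
Context (Dh_diag : is_diag ip d uh (fun x => D x + E x) (fun k => lamh k - lam j)).
Context (near : `|lamh j - lam j| <= 2 * delta * g).
Context (far : forall k, in_dim d k -> k != j ->
  (1 - 2 * delta) * g <= `|lamh k - lam j|).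
Local Notation Ph := (eig_proj ip uh j).

Let Pt_cvg x : (fun n => \sum_(0 <= p < n) P_ p x) @ \oo --> Ph x.
Proof.
exact: (proj_series_cvg ip_norm u_onb jd g_gt0 lam_gap E_sa D_diag delta_gt0
  delta_lt EAA EAP EPP CE_ge0 E_bd uh_onb Dh_diag near far).
Qed.

(** With only finitely many basis vectors kept, strong convergence lets the upper end of the tail
    tend to infinity inside a bound independent of their number. *)
Lemma proj_tail_hs_le n :
  hs_le F d u (fun x => Ph x - \sum_(0 <= p < n) P_ p x) (q ^+ n / (1 - q)).
Proof.
move=> k.
have h : (\sum_(0 <= l < k | in_dim d l)
      N (\sum_(0 <= p < m) P_ p (u l) - \sum_(0 <= p < n) P_ p (u l)) ^+ 2) @[m --> \oo]
    --> \sum_(0 <= l < k | in_dim d l) N (Ph (u l) - \sum_(0 <= p < n) P_ p (u l)) ^+ 2.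
  apply: cvg_sum => l _; rewrite expr2; under eq_fun do rewrite expr2.
  have h : N (\sum_(0 <= p < m) P_ p (u l) - \sum_(0 <= p < n) P_ p (u l)) @[m --> \oo]
      --> N (Ph (u l) - \sum_(0 <= p < n) P_ p (u l)).
    by apply: (cvg_of_nrm (F := F)); apply: cvgB => //; exact: cvg_cst.
  exact: cvgM.
apply: (ler_cvg_to h (cvg_cst _)); exists n => // m /= nm.
under eq_bigr do rewrite (big_cat_nat (n := n)) //= addrAC subrr add0r.
have hs := @hs_le_sum _ _ F _ d u nat (index_iota n m) P_ (fun p => q ^+ p)
  (fun p => exprn_gt0 p q0) (fun p _ => proj_term_hs_le p).
apply: le_trans (hs k) _.
rewrite ler_pXn2r ?nnegrE ?sumr_ge0 ?divr_ge0 ?exprn_ge0 ?(ltW q1) ?(ltW q0) //.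
  exact: geometric_tail_le.
by move=> p _; rewrite exprn_ge0 // ltW.
Qed.

Lemma proj_series_hs_cvg :
  hsnorm F d u (fun x => Ph x - \sum_(0 <= p < n) P_ p x) @[n --> \oo] --> 0%E.
Proof.
apply: (@squeeze_cvge _ _ _ _ (fun=> 0%E) _ (fun n => (q ^+ n / (1 - q))%:E)).
- apply: nearW => n; rewrite sqrte_ge0 /=; apply: hs_le_hsnorm (proj_tail_hs_le n).
  by rewrite divr_ge0 ?exprn_ge0 ?(ltW q0) ?(ltW q1).
- exact: cvg_cst.
- apply: cvg_EFin; first by apply: nearW.
  rewrite [X in X @ _](_ : _ = geometric ((1 - q)^-1) q).
    by apply: cvg_geometric; rewrite ger0_norm; case/andP: q_bd.
  by apply: funext => n; rewrite /= mulrC.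
Qed.

(** The truncated form of Dh Z_0 = Z_1: the terms [E W] telescope except for the last one. *)
Let Dh_partial n x :
  D (\sum_(0 <= p < n.+1) P_ p x) + E (\sum_(0 <= p < n.+1) P_ p x) =
  \sum_(0 <= p < n) (-1) ^+ p *: W p.+1 p x + (-1) ^+ n.+1 *: E (W n n x).
Proof.
elim: n => [|n IH].
  rewrite big_nat1 big_geq // proj_termE (linZ D_lin) (linZ E_lin).
  by rewrite (D_word_sum_n0 ip_norm u_onb jd g_gt0 lam_gap E D_diag) scaler0.
rewrite big_nat_recr //= (linD D_lin) (linD E_lin) addrACA IH.
rewrite [in RHS]big_nat_recr //= proj_termE (linZ D_lin) (linZ E_lin).
rewrite (D_word_sum ip_norm u_onb jd g_gt0 lam_gap E_sa D_diag) -scalerDr.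
rewrite -!addrA; congr (_ + _).
rewrite !exprS !mulN1r opprK !scaleNr !scalerDr.
by rewrite addrCA; congr (_ + _); rewrite addrA addNr add0r.
Qed.

Let Z_cvg x : (fun n => \sum_(0 <= p < n) (-1) ^+ p *: W p.+1 p x) @ \oo -->
  e (lamh j - lam j) *: Ph x.
Proof.
have -> : e (lamh j - lam j) *: Ph x = D (Ph x) + E (Ph x) - 0.
  rewrite subr0; apply/esym; rewrite /eig_proj /tensor.
  rewrite (linZ D_lin) (linZ E_lin) -scalerDr (is_diag_basis uh_onb Dh_diag) //.
  by rewrite !scalerA mulrC.
have -> : (fun n => \sum_(0 <= p < n) (-1) ^+ p *: W p.+1 p x) =
  (fun n => D (\sum_(0 <= p < n.+1) P_ p x) + E (\sum_(0 <= p < n.+1) P_ p x) -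
     (-1) ^+ n.+1 *: E (W n n x)).
  by apply: funext => n; rewrite Dh_partial addrK.
have Pt_cvgS : (fun n => \sum_(0 <= p < n.+1) P_ p x) @ \oo --> Ph x.
  by have := Pt_cvg (x := x); rewrite -(cvg_shiftS (fun n => \sum_(0 <= p < n) P_ p x)).
have L0 : 0 <= L by apply: le_trans (lam_bd jd); exact: normr_ge0.
apply: cvgB; first apply: cvgD.
- exact: (cvg_lin (F := F) D_lin (is_diag_bounded ip_norm u_onb D_diag L0 lam_bd)).
- exact: (cvg_lin (F := F) E_lin E_bd).
apply: (@cvg_nrm_le _ _ F _ _ _ _ _ _ (geometric (CE * N x) q)).
  move=> n; rewrite subr0 nrmZ nrm_sign mul1r (le_trans (E_bd _)) //= -mulrA ler_wpM2l //.
  rewrite mulrC; have := W_le n n x.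
  by have := wbound_above g_gt0 delta n 0; rewrite addn0 expr0 mulr1 => ->.
by apply: cvg_geometric; rewrite ger0_norm; case/andP: q_bd.
Qed.

(** Exchange of trace and series: for [k] basis vectors the number [m] of terms tends to infinity
    first, with a tail bound uniform in [k]; then [k] does. *)
Lemma eigenvalue_tail_le n :
  nrm F (\sum_(0 <= p < n) lam_ p.+1 - e (lamh j - lam j)) <=
  2 * delta * g * (q ^+ n / (1 - q)).
Proof.
pose t k p := (-1) ^+ p * ptr (W p.+1 p) k : K^o.
have tE k m : \sum_(0 <= p < m) t k p =
    ptr (fun x => \sum_(0 <= p < m) (-1) ^+ p *: W p.+1 p x) k.
  by rewrite ptrace_sum; apply: eq_bigr => p _; rewrite ptraceZ.
have tcvg k : (\sum_(0 <= p < m) t k p : K^o) @[m --> \oo] -->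
    (e (lamh j - lam j) * ptr Ph k : K^o).
  rewrite -ptraceZ; under eq_fun do rewrite tE.
  by apply: (@cvg_sum _ K^o) => l _; apply: (cvg_ipl ip_norm (y := u l)); exact: Z_cvg.
have tn k : nrm F (\sum_(0 <= p < n) t k p - e (lamh j - lam j) * ptr Ph k) <=
    2 * delta * g * (q ^+ n / (1 - q)).
  have h : (\sum_(0 <= p < n) t k p - \sum_(0 <= p < m) t k p : K^o) @[m --> \oo] -->
      (\sum_(0 <= p < n) t k p - e (lamh j - lam j) * ptr Ph k : K^o).
    by apply: (@cvgB _ K^o); [exact: cvg_cst|exact: tcvg].
  apply: (nrm_lim_le (V := K^o) _ h); exists n => // m /= nm.
  rewrite nrmBC (big_cat_nat (n := n)) //= addrAC subrr add0r.
  apply: le_trans (nrm_sum _ _ _ _) _.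
  apply: le_trans (_ : \sum_(n <= p < m) q ^+ p * (2 * delta * g) <= _).
    apply: ler_sum => p _; rewrite nrmM nrm_sign mul1r -wbS.
    exact: ptrace_word_sum_le.
  rewrite -mulr_suml mulrC ler_wpM2l ?mulr_ge0 ?(ltW g_gt0) ?(ltW delta_gt0) //.
  exact: geometric_tail_le.
have h : (\sum_(0 <= p < n) t k p - e (lamh j - lam j) * ptr Ph k : K^o) @[k --> \oo] -->
    (\sum_(0 <= p < n) lam_ p.+1 - e (lamh j - lam j) * ip (uh j) (uh j) : K^o).
  apply: (@cvgB _ K^o).
    by apply: (@cvg_sum _ K^o) => p _; exact: eigenvalue_term_cvg.
  apply: (@cvgM K^o); first exact: cvg_cst.
  exact: (tensor_ptrace_cvg ip_norm u_onb).
have := nrm_lim_le (V := K^o) (nearW _ tn) h.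
by rewrite (onb_ip uh_onb) // eqxx mulr1; apply.
Qed.

Lemma eigenvalue_series_cvg : series lam_ @ \oo --> (e (lamh j) : K^o).
Proof.
rewrite -(cvg_shiftS (series lam_)).
apply: (@cvg_nrm_le _ _ F K^o _ _ _ _ _ (geometric (2 * delta * g / (1 - q)) q)).
  move=> n.
  have -> : series lam_ n.+1 - e (lamh j) =
      \sum_(0 <= p < n) lam_ p.+1 - e (lamh j - lam j).
    by rewrite /series /= big_nat_recl //= rmorphB opprB addrAC addrC.
  apply: le_trans (eigenvalue_tail_le n) _.
  by rewrite le_eqVlt; apply/orP; left; apply/eqP; rewrite /=; field; rewrite gt_eqF.
by apply: cvg_geometric; rewrite ger0_norm; case/andP: q_bd.
Qed.

End TraceAndHS.

(** * From the spectral gap, the spectrum and [delta'] to the working bounds *)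

Section Gap.
Context (R : realType) (d : option nat) (lam : nat -> R) (j : nat).
Context (jd : in_dim d j).
Context (lam_mon : forall k l, in_dim d k -> in_dim d l -> (k <= l)%N ->
  lam l <= lam k).

Lemma gap_le_below k : in_dim d k -> (k < j)%N -> gap d lam j <= lam k - lam j.
Proof.
move=> kd kj; have k0 : (0 < k)%N by case/andP: kd.
have kj' : (k <= j.-1)%N by rewrite -ltnS prednK // (leq_ltn_trans _ kj).
have h : lam j.-1 <= lam k.
  apply: lam_mon => //; apply: (in_dim_leq jd).
  by rewrite (leq_trans k0 kj') leq_pred.
apply: le_trans (_ : lam j.-1 - lam j <= _); last by rewrite lerB.
rewrite /gap; case: eqP => [j1|_]; first by move: kj k0; rewrite j1; case: (k).
by case: ifP => _ //; rewrite ge_min lexx.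
Qed.

Lemma gap_le_above k : in_dim d k -> (j < k)%N -> gap d lam j <= lam j - lam k.
Proof.
move=> kd jk.
have h : lam k <= lam j.+1 by apply: lam_mon => //; apply: (in_dim_leq kd).
apply: le_trans (_ : lam j - lam j.+1 <= _); last by rewrite lerB.
rewrite /gap; case: eqP => [->|_]; first exact: lexx.
case: eqP => [dj|_]; last by rewrite ge_min lexx orbT.
by move: kd; rewrite /in_dim dj (leqNgt k) jk andbF.
Qed.

End Gap.

Section SpectralBound.
Context (R : realType) (K : numFieldType) (F : scalars R K).
Context (H : completeNormedModType K) (ip : {dot H for conj F}).
Context (ip_norm : norm_from_dot ip).
Context (d : option nat) (u : nat -> H) (S : H -> H) (lam : nat -> R).
Context (S_spec : spectral_decomposition ip d u S lam).

Lemma spectral_onb : orthonormal_basis ip d u.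
Proof. by case: S_spec. Qed.

Lemma spectral_is_diag : is_diag ip d u S lam.
Proof.
by move=> x k kd; apply: (coord_of_cvg ip_norm spectral_onb kd); case: S_spec.
Qed.

(** Monotonicity bounds the eigenvalues above by [lam 1]; below, the bound is the last eigenvalue in
    finite dimension and 0, by positivity, otherwise. *)
Lemma spectral_bounded : (d = None -> positive_op ip S) ->
  exists L : R, forall k, in_dim d k -> `|lam k| <= L.
Proof.
case: S_spec => _ mon _ S_pos.
have [c hc] : exists c, forall k, in_dim d k -> c <= lam k.
  case dE : d => [m|]; rewrite ?dE in mon *.
    exists (lam m) => k /andP[k0 km]; apply: mon => //; rewrite /in_dim ?k0 //=.
    by rewrite (leq_trans k0 km) leqnn.
  exists 0 => k kd; rewrite -(emb_ge0 F).
  have := S_pos dE (u k); rewrite spectral_is_diag ?dE //.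
  by rewrite (onb_ip spectral_onb) ?dE // eqxx mulr1.
exists (`|lam 1%N| + `|c|) => k kd.
have k1 : in_dim d 1 by apply: (in_dim_leq kd); case/andP: kd => ->.
have h1 : lam k <= lam 1%N by apply: mon => //; case/andP: kd.
have := hc k kd; rewrite ler_norml.
have := ler_norm (lam 1%N); have := ler_norm (- c); rewrite normrN.
have := normr_ge0 c; have := normr_ge0 (lam 1%N).
by move=> *; apply/andP; split; lra.
Qed.

End SpectralBound.

Section DeltaPrime.
Context (R : realType) (K : numFieldType) (F : scalars R K).
Context (H : completeNormedModType K) (ip : {dot H for conj F}).
Context (ip_norm : norm_from_dot ip).
Context (d : option nat) (u : nat -> H) (u_onb : orthonormal_basis ip d u).
Context (lam : nat -> R) (j : nat) (jd : in_dim d j).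
Local Notation g := (gap d lam j).
Context (g_gt0 : 0 < g).
Context (lam_gap : forall k, in_dim d k -> k != j -> g <= `|lam k - lam j|).
Context (E : H -> H) (E_sa : self_adjoint ip E).
Local Notation N := (nrm F).
Local Notation A0 := (abs_resolvent_sqrt ip d u lam j).

Lemma delta'_bounds : (delta' ip d u lam j E < (4^-1)%:E)%E ->
  exists delta : R, [/\ 0 < delta, 4 * delta < 1,
    forall x, N (A0 (E (A0 x))) <= delta * N x,
    N (A0 (E (u j))) <= delta * Num.sqrt g &
    nrm F (ip (E (u j)) (u j)) <= delta * g].
Proof.
set D := delta' _ _ _ _ _ _ => Dlt.
have gs0 : 0 < Num.sqrt g by rewrite sqrtr_gt0.
have Pj : eig_proj ip u j (u j) = u j.
  by rewrite /eig_proj /tensor (onb_ip u_onb) // eqxx scale1r.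
have D0 : (0 <= D)%E.
  rewrite /D /delta' !le_max; apply/orP; right; apply/orP; left.
  by rewrite mule_ge0 ?lee_fin ?invr_ge0 ?(ltW gs0) // sqrte_ge0.
have Dfin : D \is a fin_num.
  by rewrite ge0_fin_numE // (lt_trans Dlt) // ltry.
(* Any value strictly between 0 and 1/4 would do for 1/8: it keeps [delta] positive when [delta']
   vanishes. *)
pose delta := Num.max (fine D) 8^-1.
have Dd : (D <= delta%:E)%E by rewrite -(fineK Dfin) lee_fin le_max lexx.
(* Both Hilbert-Schmidt terms are read off at [u j], which their right factor P_j fixes. *)
have scal (c : R) (T : H -> H) : 0 < c ->
    ((c^-1)%:E * hsnorm F d u T <= D)%E -> N (T (u j)) <= delta * c.
  move=> c0 h; rewrite -ler_pdivrMr // mulrC -lee_fin EFinM.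
  apply: le_trans Dd; apply: le_trans h.
  by rewrite lee_wpmul2l ?lee_fin ?invr_ge0 ?(ltW c0) // (hsnorm_ge F u).
exists delta; split.
- by rewrite lt_max invr_gt0 ltr0n orbT.
- rewrite mulrC -ltr_pdivlMr // mul1r gt_max -lte_fin fineK // Dlt /=.
  by rewrite ltf_pV2 ?posrE // ltr_nat.
- have A0_lin := is_diag_linear ip_norm u_onb
    (abs_resolvent_sqrt_diag ip_norm u_onb g_gt0 lam_gap).
  have E_lin := adjoint_linear ip_norm E_sa.
  apply: (@opnorm_bound _ _ F _ (A0 \o E \o A0)).
    by move=> a x y /=; rewrite A0_lin E_lin A0_lin.
  by apply: le_trans Dd; rewrite /D /delta' le_max lexx.
- have := scal _ (A0 \o E \o eig_proj ip u j) gs0; rewrite /= Pj; apply.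
  by rewrite /D /delta' !le_max lexx orbT.
- have := scal _ (eig_proj ip u j \o E \o eig_proj ip u j) g_gt0.
  rewrite /= Pj {1}/eig_proj tensor_nrm (onb_nrm ip_norm u_onb) // mulr1; apply.
  by rewrite /D /delta' !le_max lexx !orbT.
Qed.

End DeltaPrime.

(** * Perturbation series of an eigenvalue and of its projection *)

Theorem corollary1 (R : realType) (K : numFieldType) (F : scalars R K)
  (H : completeNormedModType K) (ip : {dot H for conj F})
  (ip_norm : norm_from_dot ip)
  (d : option nat) (d_ge2 : if d is Some m then (2 <= m)%N else true)
  (S Sh : {linear H -> H})
  (S_sa : self_adjoint ip S) (Sh_sa : self_adjoint ip Sh)
  (S_compact : compact_op S) (Sh_compact : compact_op Sh)
  (S_pos : d = None -> positive_op ip S)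
  (Sh_pos : d = None -> positive_op ip Sh)
  (lam lamh : nat -> R) (u uh : nat -> H)
  (S_spec : spectral_decomposition ip d u S lam)
  (Sh_spec : spectral_decomposition ip d uh Sh lamh)
  (j : nat) (j_in : in_dim d j) (gap_gt0 : 0 < gap d lam j) :
  let E := fun x => Sh x - S x in
  let lam_ := eigenvalue_term ip d u lam j E in
  let P_ := proj_term ip d u lam j E in
  (delta' ip d u lam j E < (4^-1)%:E)%E ->
  [/\ (forall n, lam_ n \is Num.real) /\
        cvg (series (fun n => `|lam_ n|) @ \oo),
      (forall n, hilbert_schmidt F d u (P_ n)) /\
        (\sum_(0 <= n <oo) hsnorm F d u (P_ n) < +oo)%E,
      series lam_ @ \oo --> emb F (lamh j)
    & hsnorm F d u (fun x => eig_proj ip uh j x - \sum_(0 <= n < N) P_ n x)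
        @[N --> \oo] --> 0%E].
Proof.
move=> E lam_ P_ delta_lt.
have u_onb := spectral_onb S_spec.
have uh_onb := spectral_onb Sh_spec.
have S_diag := spectral_is_diag ip_norm S_spec.
have Sh_diag := spectral_is_diag ip_norm Sh_spec.
have lam_mon : forall k l, in_dim d k -> in_dim d l -> (k <= l)%N -> lam l <= lam k.
  by case: S_spec.
have lamh_mon : forall k l, in_dim d k -> in_dim d l -> (k <= l)%N -> lamh l <= lamh k.
  by case: Sh_spec.
have [L lam_le] := spectral_bounded ip_norm S_spec S_pos.
have [Lh lamh_le] := spectral_bounded ip_norm Sh_spec Sh_pos.
have L0 : 0 <= L by exact: le_trans (normr_ge0 _) (lam_le _ j_in).
have Lh0 : 0 <= Lh by exact: le_trans (normr_ge0 _) (lamh_le _ j_in).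
have lam_bd k : in_dim d k -> `|lam k - lam j| <= L + L.
  by move=> kd; rewrite (le_trans (ler_normB _ _)) // lerD // lam_le.
have E_sa : self_adjoint ip E by move=> x y; rewrite ipBl ipBr S_sa Sh_sa.
have E_bd x : nrm F (E x) <= (Lh + L) * nrm F x.
  rewrite mulrDl (le_trans (nrmB _ _ _)) // lerD //.
    exact: (is_diag_bounded ip_norm uh_onb Sh_diag Lh0 lamh_le).
  exact: (is_diag_bounded ip_norm u_onb S_diag L0 lam_le).
have below := gap_le_below j_in lam_mon.
have above := gap_le_above (j := j) lam_mon.
have lam_gap := gap_abs below above.
have [delta [delta_gt0 delta_lt1 EAA EAP EPP]] :=
  delta'_bounds ip_norm u_onb j_in gap_gt0 lam_gap E_sa delta_lt.
have delta2 : 2 * delta < 1 by lra.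
(* After this shift [D] vanishes on [u j], and D + E is diagonal in [uh] with eigenvalues
   [lamh k - lam j]. *)
pose D x := S x - emb F (lam j) *: x.
have D_diag : is_diag ip d u D (fun k => lam k - lam j).
  by move=> x k kd; rewrite ipBl ipZl S_diag // rmorphB mulrBl.
have Dh_diag : is_diag ip d uh (fun x => D x + E x) (fun k => lamh k - lam j).
  move=> x k kd; have -> : D x + E x = Sh x - emb F (lam j) *: x.
    by rewrite /D /E addrC addrA subrK.
  by rewrite ipBl ipZl Sh_diag // rmorphB mulrBl.
have ShE x : Sh x = S x + E x by rewrite /E addrC subrK.
have near := eigenvalue_near ip_norm u_onb j_in gap_gt0 below above lam_bd E_sa
  delta_gt0 delta2 EAA EAP EPP S_diag ShE uh_onb Sh_diag lamh_mon.
have far := eigenvalue_far ip_norm u_onb j_in gap_gt0 below above lam_bd E_sa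
  delta_gt0 delta2 EAA EAP EPP S_diag ShE uh_onb Sh_diag lamh_mon.
have CE0 : 0 <= Lh + L by rewrite addr_ge0.
split.
- split=> [n|].
    exact: (eigenvalue_term_real ip_norm u_onb j_in gap_gt0 lam_gap lam_bd E_sa D_diag
      delta_gt0 EAA EAP EPP).
  exact: (eigenvalue_term_summable ip_norm u_onb j_in gap_gt0 lam_gap lam_bd E_sa D_diag
    delta_gt0 delta_lt1 EAA EAP EPP).
- split=> [n|].
    exact: (proj_term_hilbert_schmidt ip_norm u_onb j_in gap_gt0 lam_gap E_sa
      delta_gt0 EAA EAP EPP).
  exact: (proj_term_hs_summable ip_norm u_onb j_in gap_gt0 lam_gap E_sa
    delta_gt0 delta_lt1 EAA EAP EPP).
- exact: (eigenvalue_series_cvg ip_norm u_onb j_in gap_gt0 lam_gap lam_bd E_sa D_diag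
    delta_gt0 delta_lt1 EAA EAP EPP CE0 E_bd uh_onb Dh_diag near far).
- exact: (proj_series_hs_cvg ip_norm u_onb j_in gap_gt0 lam_gap E_sa D_diag
    delta_gt0 delta_lt1 EAA EAP EPP CE0 E_bd uh_onb Dh_diag near far).
Qed.
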